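(* Let $(M,g,\Phi)$ be a $Spin(7)$ manifold with fundamental 4-form $\Phi$, let $P$ be the corresponding 3-fold vector cross product and $\nabla^g$ the Levi-Civita connection of $g$. Then for all vector fields $X,Y,Z,V,W$: $$\begin{aligned}(\nabla^g_X\Phi)(Y,Z,V,W)=\;&\tfrac12\big\{\delta\Phi(X,Y,P(Z,V,W))-\delta\Phi(X,Z,P(Y,V,W))\big\}\\&+\tfrac12\big\{\delta\Phi(X,V,P(Y,Z,W))-\delta\Phi(X,W,P(Y,Z,V))\big\}\\&-\tfrac1{12}\big\{\big( *(\delta\Phi\wedge\Phi)\big)\big(P(X,Y,P(Z,V,W))\big)-\big( *(\delta\Phi\wedge\Phi)\big)\big(P(X,Z,P(Y,V,W))\big)\big\}\\&-\tfrac1{12}\big\{\big( *(\delta\Phi\wedge\Phi)\big)\big(P(X,V,P(Y,Z,W))\big)-\big( *(\delta\Phi\wedge\Phi)\big)\big(P(X,W,P(Y,Z,V))\big)\big\}.\end{aligned}$$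
   Context: A $Spin(7)$ structure on a smooth 8-manifold $M$ is a reduction of the structure group of $TM$ to $Spin(7)\subset SO(8)$; equivalently, a nowhere vanishing 4-form $\Phi$ (the fundamental form) which near each point can be written, in some local coframe $e_0,\dots,e_7$, with $e_{ijkl}=e_i\wedge e_j\wedge e_k\wedge e_l$, as $$\Phi=e_{0123}+e_{0145}+e_{0167}+e_{0246}-e_{0257}-e_{0347}-e_{0356}+e_{4567}+e_{2367}+e_{2345}+e_{1357}-e_{1346}-e_{1247}-e_{1256}.$$ It determines a Riemannian metric $g$ and an orientation for which such coframes are oriented orthonormal; $(M,g,\Phi)$ is called a $Spin(7)$ manifold. $*$ is the Hodge operator (so $*\Phi=\Phi$) and $\delta=-*d*$ is the codifferential. Forms are evaluated so that $e_{0123}(e_0,e_1,e_2,e_3)=1$. The 3-fold vector cross product $P$ is defined by $g(P(X,Y,Z),W)=\Phi(X,Y,Z,W)$. Note that $*(\delta\Phi\wedge\Phi)$ is a 1-form. *)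

(* Defs.v *)
From HB Require Import structures.
From mathcomp Require Import all_boot all_order all_algebra all_fingroup.
From mathcomp Require Import all_classical all_reals all_analysis.

Set Implicit Arguments.
Unset Strict Implicit.
Unset Printing Implicit Defensive.

Import Order.TTheory GRing.Theory Num.Theory.
Import numFieldNormedType.Exports.

Local Open Scope classical_set_scope.
Local Open Scope ring_scope.

Section LocalCalculus.
Context {R : realType} {n : nat}.
Local Notation E := 'rV[R]_n.

(* C^infinity on an open set U: every iterated directional derivative exists
   and is (Frechet) differentiable at every point of U. *)
Definition smooth_on {F : normedModType R} (U : set E) (f : E -> F) : Prop :=
  forall (s : seq E) (x : E), U x ->
    differentiable (foldr (fun v h => 'D_v h) f s) x.

(* Covariant k-tensors on R^n, as functions of k vectors. *)
Definition kcov (k : nat) : Type := ('I_k -> E) -> R.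

Definition multilinear k (a : kcov k) : Prop :=
  forall (v : 'I_k -> E) (i : 'I_k) (c : R) (u w : E),
    a [eta v with i |-> c *: u + w] =
    c * a [eta v with i |-> u] + a [eta v with i |-> w].

Definition alternating k (a : kcov k) : Prop :=
  forall (v : 'I_k -> E) (i j : 'I_k), i != j -> v i = v j -> a v = 0.

(* Normalized so that (e_1 /\ ... /\ e_k)(v_1, ..., v_k) = det (e_i (v_j)). *)
Definition wedge k m (a : kcov k) (b : kcov m) : kcov (k + m) := fun v =>
  (k`! * m`!)%:R^-1 *
  \sum_(s : 'S_(k + m)) (-1) ^+ (s : bool) *
    a (fun i => v (s (lshift m i))) * b (fun j => v (s (rshift k j))).

Fixpoint wedge_seq (s : seq (E -> R)) : kcov (size s) :=
  match s return kcov (size s) with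
  | [::] => fun=> 1
  | e :: s' => wedge (k := 1) (fun u => e (u ord0)) (@wedge_seq s')
  end.

(* The vector obtained by raising the index of dx_i with the metric g, that is
   \sum_j g^{ij} \partial_j. *)
Definition raised_basis (g : E -> E -> R) (i : 'I_n) : E :=
  row i (invmx (\matrix_(a, b) g (delta_mx 0 a) (delta_mx 0 b))).

(* ( *a)_{j_1 ... j_m} = 1/k! a^{i_1 ... i_k} vol_{i_1 ... i_k j_1 ... j_m}, with
   the indices of a raised by g and vol the Riemannian volume form; this is the
   operator such that b /\ *a = <b, a> vol for all k-forms b. *)
Definition hodge k m (km : (k + m)%N = n) (g : E -> E -> R) (vol : kcov n)
    (a : kcov k) : kcov m := fun w =>
  k`!%:R^-1 *
  \sum_(I : {ffun 'I_k -> 'I_n})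
    a (fun b => raised_basis g (I b)) *
    vol (fun c => match fintype.split (cast_ord (esym km) c) with
                  | inl b => delta_mx 0 (I b)
                  | inr b => w b
                  end).

(* The v_i are extended to constant vector fields, which commute, so that no
   bracket terms occur. *)
Definition ext_d k (a : E -> kcov k) : E -> kcov k.+1 := fun x v =>
  \sum_(i < k.+1) (-1) ^+ i * 'D_(v i) (fun y => a y (v \o lift i)) x.

(* - * d * , with the sign valid in even dimension n. *)
Definition codiff k m (km : (k.+1 + m)%N = n) (mk : (m.+1 + k)%N = n)
    (g : E -> E -> E -> R) (vol : E -> kcov n) (a : E -> kcov k.+1) :
    E -> kcov k := fun x v =>
  - hodge mk (g x) (vol x)
      (ext_d (fun y => hodge km (g y) (vol y) (a y)) x) v.

Definition lie_bracket (X Y : E -> E) : E -> E := fun x =>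
  'D_(X x) Y x - 'D_(Y x) X x.

(* nabla_X Y, for the connection with Christoffel symbols G. *)
Definition cov_vect (G : E -> E -> E -> E) (X Y : E -> E) : E -> E := fun x =>
  'D_(X x) Y x + G x (X x) (Y x).

(* (nabla_X a)(Y_1, ..., Y_k) *)
Definition cov_form k (G : E -> E -> E -> E) (X : E -> E) (a : E -> kcov k)
    (Y : 'I_k -> E -> E) : E -> R := fun x =>
  'D_(X x) (fun y => a y (fun b => Y b y)) x -
  \sum_(c < k)
    a x (fun b => if b == c then cov_vect G X (Y b) x else Y b x).

End LocalCalculus.

Arguments kcov : clear implicits.
Arguments wedge_seq {R n} s.

(* The geometric objects on a manifold are given, as in tensor calculus, by
   their expressions in the charts of an atlas, subject to the usual
   transformation laws. Outside of the image of a chart the values of these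
   expressions are irrelevant. *)

Record manifold (R : realType) (n : nat) := Manifold {
  carrier :> topologicalType ;
  chart : Type ;
  dom : chart -> set carrier ;
  coord : chart -> carrier -> 'rV[R]_n ;
  param : chart -> 'rV[R]_n -> carrier ;
  manifold_hausdorff : hausdorff_space carrier ;
  manifold_second_countable : @second_countable carrier ;
  dom_open : forall i, open (dom i) ;
  dom_cover : forall p, exists i, dom i p ;
  coord_image_open : forall i, open (coord i @` dom i) ;
  coordK : forall i p, dom i p -> param i (coord i p) = p ;
  coord_continuous : forall i, {within dom i, continuous (coord i)} ;
  param_continuous :
    forall i, {within coord i @` dom i, continuous (param i)} ;
  transition_smooth : forall i j,
    smooth_on (coord i @` (dom i `&` dom j)) (coord j \o param i)
}.

Arguments chart {R n} M : rename.
Arguments dom {R n} M i : rename.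
Arguments coord {R n} M i : rename.
Arguments param {R n} M i : rename.

Section Fields.
Context {R : realType} {n : nat} (M : manifold R n).
Local Notation E := 'rV[R]_n.

Definition im_chart (i : chart M) : set E := coord M i @` dom M i.

Definition overlap (i j : chart M) : set E :=
  coord M i @` (dom M i `&` dom M j).

Definition transition (i j : chart M) : E -> E := coord M j \o param M i.

Record vfield := VField {
  vfield_val :> chart M -> E -> E ;
  vfield_smooth : forall i, smooth_on (im_chart i) (vfield_val i) ;
  vfield_transition : forall i j x, overlap i j x ->
    vfield_val j (transition i j x) =
    'D_(vfield_val i x) (transition i j) x
}.

Record kform (k : nat) := KForm {
  kform_val :> chart M -> E -> kcov R n k ;
  kform_multilinear : forall i x, im_chart i x -> multilinear (kform_val i x) ;
  kform_alternating : forall i x, im_chart i x -> alternating (kform_val i x) ;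
  kform_smooth : forall i (v : 'I_k -> E),
    smooth_on (im_chart i) (fun x => kform_val i x v : R) ;
  kform_transition : forall i j x (v : 'I_k -> E), overlap i j x ->
    kform_val i x v =
    kform_val j (transition i j x) (fun a => 'D_(v a) (transition i j) x)
}.

Record metric := Metric {
  metric_val :> chart M -> E -> E -> E -> R ;
  metric_linear : forall i x (c : R) (u v w : E), im_chart i x ->
    metric_val i x (c *: u + v) w =
    c * metric_val i x u w + metric_val i x v w ;
  metric_sym : forall i x (u v : E), im_chart i x ->
    metric_val i x u v = metric_val i x v u ;
  metric_pos : forall i x (u : E), im_chart i x -> u != 0 ->
    0 < metric_val i x u u ;
  metric_smooth : forall i (u v : E),
    smooth_on (im_chart i) (fun x => metric_val i x u v : R) ;
  metric_transition : forall i j x (u v : E), overlap i j x ->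
    metric_val i x u v =
    metric_val j (transition i j x)
      ('D_u (transition i j) x) ('D_v (transition i j) x)
}.

(* Affine connections on TM: conn_val i x u v has the components
   \sum_(a, b) Gamma^c_{ab}(x) u^a v^b in the chart i. *)
Record connection := Connection {
  conn_val :> chart M -> E -> E -> E -> E ;
  conn_linearl : forall i x (c : R) (u v w : E), im_chart i x ->
    conn_val i x (c *: u + v) w = c *: conn_val i x u w + conn_val i x v w ;
  conn_linearr : forall i x (c : R) (u v w : E), im_chart i x ->
    conn_val i x u (c *: v + w) = c *: conn_val i x u v + conn_val i x u w ;
  conn_smooth : forall i (u v : E),
    smooth_on (im_chart i) (fun x => conn_val i x u v) ;
  conn_transition : forall i j x (u v : E), overlap i j x ->
    'D_(conn_val i x u v) (transition i j) x =
    'D_u ('D_v (transition i j)) x +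
    conn_val j (transition i j x)
      ('D_u (transition i j) x) ('D_v (transition i j) x)
}.

Definition torsion_free (nabla : connection) : Prop :=
  forall i (X Y : E -> E) x,
    smooth_on (im_chart i) X -> smooth_on (im_chart i) Y -> im_chart i x ->
    cov_vect (nabla i) X Y x - cov_vect (nabla i) Y X x = lie_bracket X Y x.

Definition metric_compatible (g : metric) (nabla : connection) : Prop :=
  forall i (X Y Z : E -> E) x,
    smooth_on (im_chart i) X -> smooth_on (im_chart i) Y ->
    smooth_on (im_chart i) Z -> im_chart i x ->
    'D_(X x) (fun y => g i y (Y y) (Z y) : R) x =
    g i x (cov_vect (nabla i) X Y x) (Z x) +
    g i x (Y x) (cov_vect (nabla i) X Z x).

Definition levi_civita (g : metric) (nabla : connection) : Prop :=
  torsion_free nabla /\ metric_compatible g nabla.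

End Fields.

Section Spin7.
Context {R : realType}.
Local Notation E := 'rV[R]_8.

(* Smooth local coframes e_0, ..., e_7 on U; the e_a with 7 < a play no role. *)
Definition coframe_on (U : set E) (e : nat -> E -> E -> R) : Prop :=
  [/\ forall a, (a < 8)%N -> forall v, smooth_on U (fun x => e a x v : R),
      forall a, (a < 8)%N -> forall x, U x -> forall (c : R) (u v : E),
        e a x (c *: u + v) = c * e a x u + e a x v
    & forall x, U x -> forall v,
        (forall a, (a < 8)%N -> e a x v = 0) -> v = 0].

Definition wedge4 (e : nat -> E -> R) (a b c d : nat) : kcov R 8 4 :=
  wedge_seq [:: e a; e b; e c; e d].

Definition spin7_model (e : nat -> E -> R) : kcov R 8 4 := fun v =>
  wedge4 e 0 1 2 3 v + wedge4 e 0 1 4 5 v + wedge4 e 0 1 6 7 v +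
  wedge4 e 0 2 4 6 v - wedge4 e 0 2 5 7 v - wedge4 e 0 3 4 7 v -
  wedge4 e 0 3 5 6 v + wedge4 e 4 5 6 7 v + wedge4 e 2 3 6 7 v +
  wedge4 e 2 3 4 5 v + wedge4 e 1 3 5 7 v - wedge4 e 1 3 4 6 v -
  wedge4 e 1 2 4 7 v - wedge4 e 1 2 5 6 v.

Definition volume_model (e : nat -> E -> R) : kcov R 8 8 :=
  wedge_seq [seq e a | a <- iota 0 8].

Variable M : manifold R 8.

(* Phi is a Spin(7) structure with metric g and orientation the one of the
   Riemannian volume form vol: near each point, Phi has the model expression in
   a coframe which is orthonormal for g and oriented. *)
Definition spin7_structure (g : metric M) (vol : kform M 8) (Phi : kform M 4) :
    Prop :=
  forall i x, im_chart i x ->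
  exists (U : set E) (e : nat -> E -> E -> R),
    [/\ open U, U x, U `<=` im_chart i, coframe_on U e
      & forall y, U y ->
        [/\ Phi i y = spin7_model (fun a => e a y),
            forall u v, g i y u v = \sum_(a < 8) e a y u * e a y v
          & vol i y = volume_model (fun a => e a y)]].

Definition cross_product (g : metric M) (Phi : kform M 4)
    (P : chart M -> E -> E -> E -> E -> E) : Prop :=
  forall i x (u v w z : E), im_chart i x ->
    g i x (P i x u v w) z = Phi i x (tnth [tuple u; v; w; z]).

Definition delta_Phi (g : metric M) (vol : kform M 8) (Phi : kform M 4)
    (i : chart M) : E -> kcov R 8 3 :=
  codiff (k := 3) (m := 4) erefl erefl (g i) (vol i) (Phi i).

Definition star_delta_Phi_Phi (g : metric M) (vol : kform M 8)
    (Phi : kform M 4) (i : chart M) : E -> kcov R 8 1 := fun x =>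
  hodge (k := 3 + 4) (m := 1) erefl (g i x) (vol i x)
    (wedge (delta_Phi g vol Phi i x) (Phi i x)).

End Spin7.

(* Main.v *)
Require Import Defs.
From mathcomp Require Import all_boot all_order all_algebra all_fingroup.
From mathcomp Require Import all_classical all_reals all_analysis.
From mathcomp Require Import ring lra zify.

Set Implicit Arguments.
Unset Strict Implicit.
Unset Printing Implicit Defensive.

Import Order.TTheory GRing.Theory Num.Theory.
Import numFieldNormedType.Exports.

Local Open Scope classical_set_scope.
Local Open Scope ring_scope.

(** Phi has constant components in the orthonormal coframes e_0, ..., e_7 adapted
    to it. Hence, if A_X in so(8) measures how far such a frame is from being
    parallel in the direction X, then nabla_X Phi is the infinitesimal action
    A_X.Phi of A_X on the model form ([derive_Phi], [endo_act]).

    Both delta Phi and *(delta Phi /\ Phi) are algebraic in A. Since * Phi = Phi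
    near the point ([self_dual]), delta Phi is the Hodge dual of - d Phi, and d Phi
    is the alternation of the derivative of Phi. As the connection has no torsion,
    only A enters, and delta Phi is minus the divergence of A.Phi
    ([codiff_spin7]). Self-duality also makes *(delta Phi /\ Phi) a contraction
    of delta Phi with Phi ([hodge_wedge_spin7]).

    The right-hand side of the formula is - B_X.Phi for the skew endomorphism B_X
    with g (B_X Y, U) = 1/2 delta Phi (X, Y, U)
    - 1/12 *(delta Phi /\ Phi) (P (X, Y, U)). So the formula says that A_X + B_X
    annihilates Phi, that is, lies in spin(7). The complement of spin(7) in so(8)
    has dimension 7, and A_X.Phi depends only on the seven components of A_X along
    it ([act_tableE]). It therefore suffices that these components vanish for
    A_X + B_X, X running over the frame: 56 identities between linear forms in the
    56 such components of A, with rational coefficients, checked by evaluation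
    ([spin7_check]).

    Forms are evaluated on lists of vectors, so that moving, removing and
    concatenating arguments are list operations, and components are indexed by
    lists of numbers. *)

(** * Sums over lists of indices *)

Section ListSums.
Context {R : pzRingType} (n : nat).

Fixpoint nsum (k : nat) (F : seq nat -> R) : R :=
  if k is k'.+1 then \sum_(a < n) nsum k' (fun s => F (nat_of_ord a :: s))
  else F [::].

Lemma eq_nsum k (F G : seq nat -> R) :
  (forall s, size s = k -> all (ltn^~ n) s -> F s = G s) ->
  nsum k F = nsum k G.
Proof.
elim: k F G => [|k IH] F G FG /=; first exact: FG.
apply: eq_bigr => a _; apply: IH => s ss sn; apply: FG => /=; first by rewrite ss.
by rewrite ltn_ord.
Qed.

Lemma nsum_sum k I (r : seq I) (P : pred I) (F : I -> seq nat -> R) :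
  nsum k (fun s => \sum_(i <- r | P i) F i s) =
  \sum_(i <- r | P i) nsum k (F i).
Proof.
elim: k F => [//|k IH] F /=.
rewrite exchange_big /=; apply: eq_bigr => a _; exact: IH.
Qed.

Lemma nsumD k F G : nsum k (fun s => F s + G s) = nsum k F + nsum k G.
Proof.
elim: k F G => [//|k IH] F G /=.
by rewrite -big_split; apply: eq_bigr => a _; rewrite IH.
Qed.

Lemma nsumZl k c F : nsum k (fun s => c * F s) = c * nsum k F.
Proof.
elim: k F => [//|k IH] F /=.
by rewrite mulr_sumr; apply: eq_bigr => a _; rewrite IH.
Qed.

Lemma nsum0 k F : (forall s, size s = k -> all (ltn^~ n) s -> F s = 0) ->
  nsum k F = 0.
Proof.
move=> F0; have -> : nsum k F = nsum k (fun s => 0 * F s).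
  by apply: eq_nsum => s *; rewrite mul0r F0.
by rewrite nsumZl mul0r.
Qed.

Lemma nsum_cat k m F :
  nsum (k + m) F = nsum k (fun s => nsum m (fun t => F (s ++ t))).
Proof.
elim: k F => [//|k IH] F /=; by apply: eq_bigr => a _; rewrite IH.
Qed.

Definition del (T : Type) i (s : seq T) := take i s ++ drop i.+1 s.

Lemma nsum_del k i (F : nat -> seq nat -> R) : (i <= k)%N ->
  nsum k.+1 (fun s => F (nth 0%N s i) (del i s)) =
  \sum_(a < n) nsum k (F a).
Proof.
case: i => [|i] in F *.
  move=> _; apply: eq_bigr => a _; apply: eq_nsum => s _ _.
  by rewrite /del /= drop0.
elim: k i F => [|k IH] i F // ik.
transitivity (\sum_(a < n) \sum_(b < n)
    nsum k (fun s => F b (nat_of_ord a :: s))); last by rewrite exchange_big.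
apply: eq_bigr => a _.
case: i ik => [|i] ik; last exact: (IH i (fun b s => F b (nat_of_ord a :: s)) ik).
by apply: eq_bigr => b _; apply: eq_nsum => s _ _; rewrite /del /= drop0.
Qed.

End ListSums.

(** * Multilinear forms on lists of vectors *)

Section ListForms.
Context {R : realType} {V : lmodType R}.
Implicit Types (f : seq V -> R) (l r m : seq V).

Definition slot_linear k f := forall l r (c : R) u w, (size l + size r).+1 = k ->
  f (l ++ (c *: u + w) :: r) = c * f (l ++ u :: r) + f (l ++ w :: r).

Definition adjacent_zero k f := forall l r u, (size l + size r).+2 = k ->
  f (l ++ u :: u :: r) = 0.

Definition altform k f := slot_linear k f /\ adjacent_zero k f.

Variables (k : nat) (f : seq V -> R).

Lemma slotD l r u w : slot_linear k f -> (size l + size r).+1 = k ->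
  f (l ++ (u + w) :: r) = f (l ++ u :: r) + f (l ++ w :: r).
Proof. by move=> fL s; rewrite -[u in u + w]scale1r fL // mul1r. Qed.

Lemma slot0 l r : slot_linear k f -> (size l + size r).+1 = k ->
  f (l ++ 0 :: r) = 0.
Proof.
move=> fL s; have /eqP := @slotD l r 0 0 fL s.
by rewrite addr0 -subr_eq subrr eq_sym => /eqP.
Qed.

Lemma slotZ l r c u : slot_linear k f -> (size l + size r).+1 = k ->
  f (l ++ (c *: u) :: r) = c * f (l ++ u :: r).
Proof. by move=> fL s; rewrite -[c *: u]addr0 fL // slot0 // addr0. Qed.

Lemma slot_sum l r I (s : seq I) (P : pred I) (c : I -> R) (u : I -> V) :
  slot_linear k f -> (size l + size r).+1 = k ->
  f (l ++ (\sum_(i <- s | P i) c i *: u i) :: r) =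
  \sum_(i <- s | P i) c i * f (l ++ u i :: r).
Proof.
move=> fL sz; elim: s => [|i s IH]; first by rewrite !big_nil slot0.
by rewrite !big_cons; case: ifP => _ //; rewrite fL // IH.
Qed.

Lemma altform_swap l r u w : altform k f -> (size l + size r).+2 = k ->
  f (l ++ u :: w :: r) = - f (l ++ w :: u :: r).
Proof.
move=> [fL f0] s.
have := f0 l r (u + w) s; rewrite slotD //=; last by rewrite addnS.
rewrite -(cat1s u) -(cat1s w) !catA !slotD ?size_cat ?addn1 -?catA //= !f0 //.
by rewrite add0r addr0 => /eqP; rewrite addr_eq0 => /eqP.
Qed.

Lemma altform_move l m r u : altform k f -> (size l + size m + size r).+1 = k ->
  f (l ++ u :: m ++ r) = (-1) ^+ size m * f (l ++ m ++ u :: r).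
Proof.
move=> fA; elim: m l => [|w m IH] l s /=; first by rewrite mul1r.
rewrite altform_swap //; last by rewrite -s /= size_cat; lia.
rewrite -(cat1s w) catA IH ?size_cat /=; last by rewrite -s /=; lia.
by rewrite -catA exprS mulN1r mulNr.
Qed.

Lemma altform_move_block l m1 m2 r : altform k f ->
  (size l + size m1 + size m2 + size r)%N = k ->
  f (l ++ m1 ++ m2 ++ r) =
  (-1) ^+ (size m1 * size m2) * f (l ++ m2 ++ m1 ++ r).
Proof.
move=> fA; elim: m1 l => [|u m1 IH] l s /=; first by rewrite mul1r.
rewrite -(cat1s u) catA IH; last by rewrite -s size_cat /=; lia.
rewrite -catA /= altform_move //; last by rewrite -s /= size_cat; lia.
by rewrite mulrA -exprD mulSn addnC.
Qed.

Lemma altform_front x0 i s t : altform k f -> (size s + size t)%N = k ->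
  (i < size s)%N ->
  f (s ++ t) = (-1) ^+ i * f (nth x0 s i :: del i s ++ t).
Proof.
move=> fA sk si.
have es : s = take i s ++ nth x0 s i :: drop i.+1 s.
  by rewrite -drop_nth // cat_take_drop.
have sti : size (take i s) = i by rewrite size_takel // ltnW.
have := @altform_move [::] (take i s) (drop i.+1 s ++ t) (nth x0 s i) fA.
rewrite /del /= sti -catA => -> /=; last first.
  by rewrite size_cat size_drop -sk; move: si; clear; lia.
by rewrite signrMK {1}es -catA.
Qed.

End ListForms.

Section ListFormContexts.
Context {R : realType} {V : lmodType R}.
Implicit Types (f : seq V -> R) (l r m : seq V).

Lemma slot_linear_ctx k f l r : slot_linear (size l + k + size r) f ->
  slot_linear k (fun s => f (l ++ s ++ r)).
Proof.
move=> fL a b c u w s.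
have -> x : l ++ (a ++ x :: b) ++ r = (l ++ a) ++ x :: (b ++ r).
  by rewrite -!catA.
by rewrite !fL // -?catA // !size_cat; lia.
Qed.

Lemma altform_ctx k f l r : altform (size l + k + size r) f ->
  altform k (fun s => f (l ++ s ++ r)).
Proof.
move=> [fL f0]; split; first exact: slot_linear_ctx.
move=> a b u s.
have -> : l ++ (a ++ [:: u, u & b]) ++ r = (l ++ a) ++ [:: u, u & (b ++ r)].
  by rewrite -!catA.
by rewrite f0 // !size_cat; lia.
Qed.

Lemma altform_dup k f l m r u : altform k f ->
  (size l + size m + size r).+2 = k -> f (l ++ u :: m ++ u :: r) = 0.
Proof.
move=> fA s; rewrite (altform_move (k := k)) //=; last by rewrite -s /=; lia.
by rewrite catA (proj2 fA) ?mulr0 // size_cat.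
Qed.

(** The hypothesis on r and d says that, in the basis E, the sum of the tensors
    r_i * d_i is the sum of the E_a * E_a; it is applied in each of the k slots. *)
Lemma nsum_change_frame n k (A B : seq V -> R) (e : nat -> V -> R)
    (E r d : nat -> V) :
  slot_linear k A -> slot_linear k B ->
  (forall v, v = \sum_(a < n) e a v *: E a) ->
  (forall a b : 'I_n, \sum_(i < n) e a (r i) * e b (d i) = (a == b)%:R) ->
  nsum n k (fun I => A (map r I) * B (map d I)) =
  nsum n k (fun I => A (map E I) * B (map E I)).
Proof.
move=> + + eE rd; elim: k A B => [//|k IH] A B AL BL /=.
transitivity (\sum_(i < n) nsum n k (fun I =>
    A (r i :: map E I) * B (d i :: map E I))).
  apply: eq_bigr => i _.
  apply: (IH (fun s => A (r i :: s)) (fun s => B (d i :: s))).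
    have := @slot_linear_ctx k A [:: r i] [::]; rewrite /= addn0 => /(_ AL).
    by under [X in slot_linear _ X -> _]eq_fun do rewrite cats0.
  have := @slot_linear_ctx k B [:: d i] [::]; rewrite /= addn0 => /(_ BL).
  by under [X in slot_linear _ X -> _]eq_fun do rewrite cats0.
rewrite -!nsum_sum; apply: eq_nsum => I sI _.
have expand (F : seq V -> R) v : slot_linear k.+1 F ->
    F (v :: map E I) = \sum_(a < n) e a v * F (E a :: map E I).
  move=> FL; rewrite {1}[v]eE.
  by rewrite (@slot_sum _ _ k.+1 F [::]) //= size_map sI.
under eq_bigr => i _ do
  rewrite (expand A) // (expand B) // mulr_suml.
rewrite exchange_big /=; apply: eq_bigr => a _.
under eq_bigr => i _ do rewrite mulr_sumr.
rewrite exchange_big (bigD1 a) //= [X in _ + X]big1 => [|b ba].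
  under eq_bigr => i _ do rewrite mulrACA.
  by rewrite -mulr_suml rd eqxx mul1r addr0.
under eq_bigr => i _ do rewrite mulrACA.
by rewrite -mulr_suml rd eq_sym (negPf ba) mul0r.
Qed.

End ListFormContexts.

(** * Covariant tensors as forms on lists *)

Section Kcov.
Context {R : realType} {n : nat}.
Local Notation E := 'rV[R]_n.

Definition eval_list k (a : kcov R n k) (s : seq E) : R :=
  a (fun i : 'I_k => nth 0 s i).

Lemma eval_listE k (a : kcov R n k) v : a v = eval_list a [seq v i | i <- enum 'I_k].
Proof.
congr a; apply/funext => i.
by rewrite (nth_map i) ?nth_ord_enum // size_enum_ord.
Qed.

Lemma slot_linear_eval_list k (a : kcov R n k) :
  multilinear a -> slot_linear k (eval_list a).
Proof.
move=> aL l r c u w s.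
have lk : (size l < k)%N by rewrite -s; lia.
have upd x : eval_list a (l ++ x :: r) =
    a [eta (fun i : 'I_k => nth 0 (l ++ 0 :: r) i) with Ordinal lk |-> x].
  congr a; apply/funext => i /=; rewrite !nth_cat -val_eqE /=.
  case: ltngtP => // [il|->]; last by rewrite subnn.
  by case: (i - size l)%N (subn_gt0 (size l) i) => [|j] //=; rewrite il.
by rewrite !upd aL.
Qed.

Lemma altform_eval_list k (a : kcov R n k) : multilinear a -> Defs.alternating a ->
  altform k (eval_list a).
Proof.
move=> aL a0; split=> [|l r u s]; first exact: slot_linear_eval_list.
have lk : (size l < k)%N by rewrite -s; lia.
have lk1 : ((size l).+1 < k)%N by rewrite -s; lia.
apply: (a0 _ (Ordinal lk) (Ordinal lk1)).
  by rewrite -val_eqE /= neq_ltn leqnn.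
by rewrite /= !nth_cat ltnn subnn ltnNge leqnSn /= subSnn.
Qed.

Lemma multilinear_list k f : slot_linear k f ->
  multilinear (fun v : 'I_k -> E => f [seq v i | i <- enum 'I_k]).
Proof.
move=> fL v i c u w.
have upd x : [seq [eta v with i |-> x] j | j <- enum 'I_k] =
   take i [seq v j | j <- enum 'I_k] ++ x :: drop i.+1 [seq v j | j <- enum 'I_k].
  apply: (@eq_from_nth _ 0).
    rewrite size_cat /= size_take size_drop !size_map -enumT !size_enum_ord ltn_ord.
    have := ltn_ord i; lia.
  move=> j; rewrite size_map size_enum_ord => jk.
  have jj : nth i (enum 'I_k) j = Ordinal jk.
    by apply: val_inj; rewrite /= nth_enum_ord.
  rewrite (nth_map i) ?size_enum_ord // jj /=.
  rewrite nth_cat size_take !size_map -enumT size_enum_ord ltn_ord.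
  rewrite -val_eqE /=.
  case: ltngtP => [ji|ij|ji]; last by rewrite ji subnn.
    by rewrite nth_take // (nth_map i) ?size_enum_ord // jj.
  rewrite -[(j - i)%N]prednK ?subn_gt0 //= nth_drop addSnnS prednK ?subn_gt0 //.
  by rewrite subnKC ?(ltnW ij) // (nth_map i) ?size_enum_ord // jj.
rewrite !upd fL //.
rewrite size_take size_drop !size_map -enumT !size_enum_ord ltn_ord.
have := ltn_ord i; lia.
Qed.

Lemma alternating_list k f : altform k f ->
  Defs.alternating (fun v : 'I_k -> E => f [seq v i | i <- enum 'I_k]).
Proof.
move=> fA v i j; wlog ij : i j / (i < j)%N.
  move=> W ij vij; case: (ltngtP i j) => // [lt|lt|/val_inj eq].
  - exact: (W i j).
  - by apply: (W j i) => //; rewrite eq_sym.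
  - by rewrite eq eqxx in ij.
move=> _ vij; set s := [seq v i | i <- enum 'I_k].
have ss : size s = k by rewrite size_map size_enum_ord.
have sn (p : 'I_k) : nth 0 s p = v p.
  by rewrite (nth_map p) ?nth_ord_enum ?size_enum_ord.
have es : s = take i s ++ v i :: take (j - i).-1 (drop i.+1 s) ++ v i :: drop j.+1 s.
  rewrite -{1}(cat_take_drop i s) (drop_nth 0) ?ss // sn; congr (_ ++ _ :: _).
  rewrite -{1}(cat_take_drop (j - i).-1 (drop i.+1 s)); congr (_ ++ _).
  have ji : ((j - i).-1 + i.+1)%N = j by move: ij; lia.
  by rewrite drop_drop ji (drop_nth 0) ?ss // sn vij.
rewrite es (altform_dup _ fA) // !size_take !size_drop ss ltn_ord.
by move: ij (ltn_ord j); clear; case: ifP; lia.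
Qed.

Lemma multilinear_tperm k (a : kcov R n k) v i j :
  multilinear a -> Defs.alternating a -> i != j ->
  a (v \o tperm i j) = - a v.
Proof.
move=> aL a0 ij.
have zero u : a [eta [eta v with i |-> u] with j |-> u] = 0.
  by apply: (a0 _ i j) => //=; rewrite eqxx (negPf ij) eqxx.
have addj w u u' : a [eta w with j |-> u + u'] =
    a [eta w with j |-> u] + a [eta w with j |-> u'].
  by rewrite -{1}[u]scale1r aL mul1r.
have addi u u' w : a [eta [eta v with i |-> u + u'] with j |-> w] =
    a [eta [eta v with i |-> u] with j |-> w] +
    a [eta [eta v with i |-> u'] with j |-> w].
  have sw x : [eta [eta v with i |-> x] with j |-> w] =
              [eta [eta v with j |-> w] with i |-> x] :> ('I_k -> 'rV[R]_n).
    apply/funext => l /=; case: eqP => [->|//].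
    by rewrite eq_sym (negPf ij).
  by rewrite !sw -{1}[u]scale1r aL mul1r.
have := zero (v i + v j); rewrite addj !addi !zero add0r addr0 => /eqP.
rewrite addr_eq0 => /eqP h.
have e1 : v \o tperm i j = [eta [eta v with i |-> v j] with j |-> v i]
    :> ('I_k -> 'rV[R]_n).
  apply/funext => l /=; case: tpermP => [->|->|/eqP li /eqP lj].
  - by rewrite (negPf ij) eqxx.
  - by rewrite eqxx.
  - by rewrite (negPf li) (negPf lj).
have e2 : [eta [eta v with i |-> v i] with j |-> v j] = v
    :> ('I_k -> 'rV[R]_n).
  by apply/funext => l /=; do 2 (case: eqP => [->//|_]).
by rewrite e1 h e2.
Qed.

Lemma multilinear_perm k (a : kcov R n k) v (s : 'S_k) :
  multilinear a -> Defs.alternating a ->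
  a (v \o s) = (-1) ^+ (s : bool) * a v.
Proof.
move=> aL a0; case: (prod_tpermP s) => ts -> /=.
elim: ts v => [|[i j] ts IH] v /=.
  move=> _; rewrite big_nil odd_perm1 mul1r; congr a.
  by apply/funext => i /=; rewrite perm1.
case/andP=> ij dts; rewrite big_cons odd_permM odd_tperm ij signr_addb.
have -> : v \o (tperm i j * \prod_(t <- ts) tperm t.1 t.2)%g =
   (v \o (\prod_(t <- ts) tperm t.1 t.2)%g) \o tperm i j.
  by apply/funext => l /=; rewrite permM.
by rewrite multilinear_tperm // IH //= expr1 mulN1r mulNr.
Qed.

End Kcov.

(** * Products of 1-forms as determinants *)

Section WedgeDet.
Context {R : realType} {n : nat}.
Local Notation E := 'rV[R]_n.
Implicit Types (s : seq (E -> R)) (vs : seq E).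

(** In the permutation sum of a wedge product with a 1-form, a permutation of the
    last m arguments can be absorbed by the last factor, a determinant; this
    happens m! times, which cancels the normalization. *)
Lemma wedge_seq_det s (v : 'I_(size s) -> E) :
  wedge_seq s v = \det (\matrix_(i, j) nth (fun=> 0) s i (v j)).
Proof.
elim: s v => [|f s IH] v; first by rewrite /= det_mx00.
rewrite [LHS]/= /wedge /=; set m := size s.
pose F (t : 'S_m.+1) := (-1) ^+ (t : bool) *
  \prod_(i < m.+1) nth (fun=> 0) (f :: s) i (v (t i)) : R.
have -> : \det (\matrix_(i, j) nth (fun=> 0) (f :: s) i (v j)) =
    \sum_(t : 'S_m.+1) F t.
  by apply: eq_bigr => t _; congr (_ * _); apply: eq_bigr => i _; rewrite mxE.
transitivity ((1`! * m`!)%:R^-1 * \sum_(t : 'S_m) \sum_(u : 'S_m.+1)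
    F (lift0_perm t * u)%g).
  congr (_ * _); rewrite exchange_big /=; apply: eq_bigr => u _.
  rewrite IH /determinant mulr_sumr; apply: eq_bigr => t _.
  rewrite /F odd_permM odd_lift_perm /= big_ord_recl /= permM lift0_perm0.
  rewrite signr_addb.
  have -> : lshift m (ord0 : 'I_1) = ord0 :> 'I_m.+1 by apply: val_inj.
  under [in RHS]eq_bigr => i _ do rewrite permM lift0_perm_lift.
  under eq_bigr => i _ do rewrite mxE.
  have -> (a b c d : R) : a * b * (c * d) = c * a * (b * d) by ring.
  do 2 congr (_ * _); apply: eq_bigr => i _.
  by congr (nth _ _ _ (v (u _))); apply: val_inj.
have -> : \sum_(t : 'S_m) \sum_(u : 'S_m.+1) F (lift0_perm t * u)%g =
    \sum_(t : 'S_m) \sum_(u : 'S_m.+1) F u.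
  apply: eq_bigr => t _; symmetry.
  rewrite (reindex_inj (@mulgI _ (lift0_perm t))) /=.
  by apply: eq_bigl => u.
rewrite sumr_const (_ : #|{perm 'I_m}| = m`!); last by rewrite card_Sn.
rewrite mul1n -[X in _ * X]mulr_natl mulrA mulVf ?mul1r //.
Qed.

(** The determinant of the s_i(v_j), by Laplace expansion along the first vector:
    when this vector belongs to the dual frame, at most one term remains. *)
Fixpoint wdet vs s : R :=
  if vs is v :: vs' then
    \sum_(i < size s) (-1) ^+ i * nth (fun=> 0) s i v * wdet vs' (del i s)
  else 1.

Lemma nth_del T (x0 : T) (s : seq T) i j : (i < size s)%N ->
  nth x0 (del i s) j = nth x0 s (bump i j).
Proof.
move=> si; rewrite /del nth_cat size_take si /bump.
case: leqP => ij; last by rewrite nth_take.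
by rewrite nth_drop; congr (nth _ _ _); lia.
Qed.

Lemma size_del T (s : seq T) i : (i < size s)%N -> size (del i s) = (size s).-1.
Proof. by move=> si; rewrite size_cat size_drop size_takel 1?ltnW //; lia. Qed.

Lemma det_wdet m s vs : size s = m -> size vs = m ->
  \det (\matrix_(i < m, j < m) nth (fun=> 0) s i (nth 0 vs j)) = wdet vs s.
Proof.
elim: m s vs => [|m IH] s [|v vs] //= ss; first by rewrite det_mx00.
case=> sv; rewrite ss (expand_det_col _ ord0); apply: eq_bigr => i _.
rewrite !mxE /cofactor addn0 /= mulrA [_ * (-1) ^+ _]mulrC; congr (_ * _).
rewrite -IH ?size_del ?ss //; congr (\det _).
by apply/matrixP => a b; rewrite !mxE nth_del ?ss.
Qed.

Lemma wedge_seq_wdet s vs :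
  size vs = size s -> eval_list (wedge_seq s) vs = wdet vs s.
Proof. by move=> svs; rewrite /eval_list wedge_seq_det det_wdet. Qed.

(** This sum is the value of f /\ s, the Laplace expansion along f of a determinant
    with two equal rows. *)
Lemma wdet_repeated s f us : size us = (size s).+1 ->
  (exists2 i, (i < size s)%N & nth (fun=> 0) s i = f) ->
  \sum_(i < size us) (-1) ^+ i * f (nth 0 us i) * wdet (del i us) s = 0.
Proof.
move=> su [i0 si0 fi0]; rewrite su; set m := size s.
pose A := \matrix_(i < m.+1, j < m.+1) nth (fun=> 0) (f :: s) i (nth 0 us j).
transitivity (\det A); last first.
  apply: (@determinant_alternate _ _ _ ord0 (lift ord0 (Ordinal si0))) => //.
  by move=> j; rewrite !mxE /= fi0.
rewrite (expand_det_row _ ord0); apply: eq_bigr => i _.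
rewrite !mxE /cofactor add0n /= mulrA [_ * (-1) ^+ _]mulrC; congr (_ * _).
rewrite -(@det_wdet m) ?size_del ?su //; congr (\det _).
by apply/matrixP => a b; rewrite !mxE nth_del ?su.
Qed.

End WedgeDet.

(** * The Hodge operator in an orthonormal frame *)

Section FiniteSums.
Context {R : realType} {n : nat}.

Lemma nsum_ffun k (F : seq nat -> R) :
  \sum_(I : {ffun 'I_k -> 'I_n}) F [seq val (I b) | b <- enum 'I_k] = nsum n k F.
Proof.
elim: k F => [|k IH] F.
  rewrite (big_pred1 (ffun0 (card_ord 0))).
    by rewrite (size0nil (size_enum_ord 0)).
  by move=> I; apply/esym/eqP/ffunP => -[].
pose fc (p : 'I_n * {ffun 'I_k -> 'I_n}) : {ffun 'I_k.+1 -> 'I_n} :=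
  [ffun i => if unlift ord0 i is Some j then p.2 j else p.1].
rewrite (reindex fc) /=; last first.
  exists (fun I => (I ord0, [ffun j => I (lift ord0 j)])) => [[a J]|I] _ /=.
    rewrite ffunE unlift_none; congr pair; apply/ffunP => j.
    by rewrite !ffunE liftK.
  by apply/ffunP => i; rewrite !ffunE; case: unliftP => [j|] ->; rewrite ?ffunE.
transitivity (\sum_(a < n) \sum_(J : {ffun 'I_k -> 'I_n}) F
   (val a :: [seq val (J b) | b <- enum 'I_k])); last first.
  by apply: eq_bigr => a _; exact: IH.
rewrite pair_big /=; apply: eq_bigr => -[a J] _ /=; congr F.
rewrite enum_ordSl /= ffunE unlift_none; congr (_ :: _).
by rewrite -map_comp; apply: eq_map => b; rewrite /= ffunE liftK.
Qed.

End FiniteSums.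

Section Frames.
Context {R : realType} {n : nat}.
Local Notation E := 'rV[R]_n.

Definition dual_bases (e : nat -> E -> R) (Ev : nat -> E) : Prop :=
  [/\ forall a, (a < n)%N -> forall (c : R) (u v : E),
        e a (c *: u + v) = c * e a u + e a v,
      forall a b, (a < n)%N -> (b < n)%N -> e a (Ev b) = (a == b)%:R
    & forall v, v = \sum_(a < n) e a v *: Ev a].

Variables (e : nat -> E -> R) (Ev : nat -> E).
Hypothesis eEv : dual_bases e Ev.

Let eL a : (a < n)%N -> forall (c : R) (u v : E),
  e a (c *: u + v) = c * e a u + e a v.
Proof. by case: eEv => h _ _; exact: h. Qed.

Let eE a b : (a < n)%N -> (b < n)%N -> e a (Ev b) = (a == b)%:R.
Proof. by case: eEv => _ h _; exact: h. Qed.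

Let expE v : v = \sum_(a < n) e a v *: Ev a.
Proof. by case: eEv. Qed.

Lemma coframe_sum a I (s : seq I) (P : pred I) (c : I -> R) (u : I -> E) :
  (a < n)%N -> e a (\sum_(i <- s | P i) c i *: u i) =
  \sum_(i <- s | P i) c i * e a (u i).
Proof.
move=> an; have e0 : e a 0 = 0.
  have := @eL _ an 1 0 0; rewrite scaler0 addr0 mul1r => /eqP.
  by rewrite -subr_eq subrr eq_sym => /eqP.
elim/big_rec2: _ => [//|i x y _ <-]; by rewrite eL.
Qed.

Lemma frame_expand k (f : seq E -> R) l r v : slot_linear k f ->
  (size l + size r).+1 = k ->
  f (l ++ v :: r) = \sum_(a < n) e a v * f (l ++ Ev a :: r).
Proof. by move=> fL s; rewrite {1}[v]expE (slot_sum (k := k)). Qed.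

(** Contracting with a decomposable form e_s puts the vectors E_s in the first
    slots, once for each of the k! orderings. *)
Lemma wdet_contract k (f : seq E -> R) s : altform k f -> size s = k ->
  all (ltn^~ n) s ->
  nsum n k (fun I => wdet (map Ev I) (map e s) * f (map Ev I)) =
  k`!%:R * f (map Ev s).
Proof.
elim: k f s => [|k IH] f s fA ss sn.
  by rewrite (size0nil ss) /= mul1r.
rewrite /= size_map ss.
have snth i : (i < k.+1)%N -> (nth 0%N s i < n)%N.
  by move=> ik; apply: (allP sn); rewrite mem_nth ?ss.
transitivity (\sum_(a < n) \sum_(i < k.+1) (-1) ^+ i *
   (nth 0%N s i == a)%:R * (k`!%:R * f (Ev a :: map Ev (del i s)))).
  apply: eq_bigr => a _.
  under eq_nsum => I _ _ do rewrite mulr_suml.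
  rewrite nsum_sum; apply: eq_bigr => i _.
  rewrite -(IH (fun t => f (Ev a :: t))) ?size_del ?ss //; first last.
  - apply/allP => x; rewrite mem_cat => /orP[/mem_take|/mem_drop];
      exact: (allP sn).
  - have := @altform_ctx _ _ k f [:: Ev a] [::]; rewrite /= addn0 => /(_ fA).
    by under [X in altform _ X -> _]eq_fun do rewrite cats0.
  rewrite -nsumZl; apply: eq_nsum => I _ _.
  rewrite (nth_map 0%N) ?ss // eE // ?snth //.
  by rewrite /del -map_drop -map_take -map_cat !mulrA.
rewrite exchange_big /=.
transitivity (\sum_(i < k.+1) k`!%:R * f (map Ev s)); last first.
  by rewrite sumr_const card_ord -[LHS]mulr_natl mulrA -natrM factS.
apply: eq_bigr => i _.
rewrite (bigD1 (Ordinal (snth i (ltn_ord i)))) //= big1 => [|a ai]; last first.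
  rewrite -val_eqE /= eq_sym in ai.
  by rewrite (negPf ai) mulr0 mul0r.
rewrite eqxx mulr1 addr0 mulrCA; congr (_ * _).
have := @altform_front _ _ _ f 0 i (map Ev s) [::] fA.
rewrite !cats0 !size_map ss addn0 => /(_ erefl (ltn_ord i)) ->.
by rewrite (nth_map 0%N) ?ss // /del map_cat map_take map_drop.
Qed.

Section Hodge.
Variable g : E -> E -> R.
Hypothesis gE : forall u v, g u v = \sum_(a < n) e a u * e a v.

Let d (i : 'I_n) : E := delta_mx 0 i.
Let C : 'M[R]_n := \matrix_(a, j) e a (d j).
Let D : 'M[R]_n := \matrix_(j, a) Ev a 0 j.

Let eC (a : 'I_n) v : e a v = \sum_j C a j * v 0 j.
Proof.
rewrite {1}[v]row_sum_delta coframe_sum //.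
by apply: eq_bigr => j _; rewrite !mxE mulrC.
Qed.

Let CD : C *m D = 1%:M.
Proof.
apply/matrixP => a b; rewrite !mxE -[RHS](eE (ltn_ord a) (ltn_ord b)) eC.
by apply: eq_bigr => j _; rewrite !mxE.
Qed.

Lemma raised_basis_frame (a b : 'I_n) :
  \sum_(i < n) e a (raised_basis g i) * e b (d i) = (a == b)%:R.
Proof.
have DC := mulmx1C CD.
set G := \matrix_(i, j) g (d i) (d j).
have GE : G = C^T *m C.
  by apply/matrixP => i j; rewrite !mxE gE; apply: eq_bigr => c _; rewrite !mxE.
have DG : (D *m D^T) *m G = 1%:M.
  by rewrite GE -!mulmxA (mulmxA D^T) -trmx_mul CD trmx1 mul1mx.
have Gu : G \in unitmx by case: (mulmx1_unit DG).
have GD : invmx G = D *m D^T.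
  by rewrite -[RHS]mulmx1 -(mulmxV Gu) mulmxA DG mul1mx.
have rD i : e a (raised_basis g i) = D i a.
  rewrite eC /raised_basis GD.
  transitivity ((D *m (D^T *m C^T)) i a); last first.
    by rewrite -trmx_mul CD trmx1 mulmx1.
  rewrite mulmxA !mxE; apply: eq_bigr => j _.
  by rewrite mulrC !mxE.
transitivity ((C *m D) b a); last by rewrite CD mxE eq_sym.
by rewrite mxE; apply: eq_bigr => i _; rewrite rD mulrC [C b i]mxE.
Qed.

(** The raised basis and the coordinate basis are dual for g, as an orthonormal
    frame is with itself; so they can be replaced by such a frame. *)
Lemma hodge_frame k m (km : (k + m)%N = n) (vol : kcov R n n) (a : kcov R n k) w :
  slot_linear k (eval_list a) -> slot_linear n (eval_list vol) ->
  hodge km g vol a w = k`!%:R^-1 *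
  nsum n k (fun I => eval_list a (map Ev I) *
    eval_list vol (map Ev I ++ [seq w b | b <- enum 'I_m])).
Proof.
move=> aL vL; set W := [seq w b | b <- enum 'I_m].
have sW : size W = m by rewrite size_map size_enum_ord.
pose ext (f : 'I_n -> E) i := oapp f 0 (insub i).
have extE f (i : 'I_n) : ext f i = f i by rewrite /ext valK.
rewrite /hodge; congr (_ * _).
rewrite -(@nsum_change_frame _ _ n k (eval_list a)
  (fun s => eval_list vol (s ++ W)) e Ev
  (ext (raised_basis g)) (ext d)) //; first last.
- move=> a' b'; rewrite -[RHS]raised_basis_frame.
  by apply: eq_bigr => i _; rewrite !extE.
- by apply: (@slot_linear_ctx _ _ k (eval_list vol) [::] W); rewrite /= add0n sW km.
rewrite -nsum_ffun; apply: eq_bigr => I _; congr (_ * _).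
  rewrite eval_listE; congr eval_list; rewrite -map_comp; apply: eq_map => b /=.
  by rewrite extE.
congr vol; apply/funext => c; rewrite nth_cat !size_map -enumT size_enum_ord.
case: splitP => j /= cj.
  have jk : (c < k)%N by rewrite cj.
  rewrite jk -map_comp (nth_map j) ?size_enum_ord // cj nth_ord_enum /=.
  by rewrite extE.
by rewrite cj ltnNge leq_addr /= addKn (nth_map j) ?size_enum_ord // nth_ord_enum.
Qed.

End Hodge.

(** The antisymmetrization in a /\ b is absorbed by the alternating form h: each of
    the (k + m)! permutations contributes the same sum. *)
Lemma nsum_wedge k m (a : kcov R n k) (b : kcov R n m) (h : seq E -> R) :
  altform (k + m) h ->
  nsum n (k + m) (fun I => eval_list (wedge a b) (map Ev I) * h (map Ev I)) =
  (k + m)`!%:R * ((k`! * m`!)%:R^-1 *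
   nsum n k (fun J => nsum n m (fun K =>
    eval_list a (map Ev J) * eval_list b (map Ev K) * h (map Ev J ++ map Ev K)))).
Proof.
move=> hA.
pose H (v : 'I_(k + m) -> E) := h [seq v i | i <- enum 'I_(k + m)].
have Hp v (s : 'S_(k + m)) : H (v \o s) = (-1) ^+ (s : bool) * H v.
  apply: multilinear_perm; last exact: alternating_list.
  by apply: multilinear_list; case: hA.
pose G (v : 'I_(k + m) -> E) :=
  a (fun i => v (lshift m i)) * b (fun j => v (rshift k j)).
pose EI (I : {ffun 'I_(k + m) -> 'I_n}) (b : 'I_(k + m)) : E := Ev (I b).
pose c : R := (k`! * m`!)%:R^-1.
rewrite -nsum_ffun.
transitivity (\sum_(I : {ffun 'I_(k + m) -> 'I_n}) \sum_(s : 'S_(k + m))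
   c * (G (EI I \o s) * H (EI I \o s))).
  apply: eq_bigr => I _.
  have -> : [seq Ev i | i <- [seq val (I b) | b <- enum 'I_(k + m)]] =
      [seq EI I b | b <- enum 'I_(k + m)] by rewrite -map_comp.
  rewrite -eval_listE -/(H (EI I)) /wedge -mulrA mulr_suml mulr_sumr.
  apply: eq_bigr => s _; rewrite Hp /G /= -/c.
  have arr (x y z w : R) : x * y * z * w = y * z * (x * w) by ring.
  by congr (_ * _); exact: arr.
rewrite exchange_big /=.
transitivity (\sum_(s : 'S_(k + m)) (c * nsum n k (fun J => nsum n m (fun K =>
    eval_list a (map Ev J) * eval_list b (map Ev K) *
    h (map Ev J ++ map Ev K))))); last first.
  rewrite sumr_const (_ : #|{perm 'I_(k + m)}| = (k + m)`!) ?card_Sn //.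
  by rewrite -[LHS]mulr_natl.
apply: eq_bigr => s _; rewrite -mulr_sumr; congr (_ * _).
pose fs (I : {ffun 'I_(k + m) -> 'I_n}) := [ffun i => I (s i)].
transitivity (\sum_(I : {ffun 'I_(k + m) -> 'I_n}) G (EI I) * H (EI I)).
  rewrite [RHS](reindex fs) /=; last first.
    exists (fun I : {ffun 'I_(k + m) -> 'I_n} => [ffun i => I ((s^-1)%g i)]).
      by move=> I _; apply/ffunP => i; rewrite !ffunE permKV.
    by move=> I _; apply/ffunP => i; rewrite !ffunE permK.
  apply: eq_bigr => I _.
  have -> // : EI (fs I) = EI I \o s.
  by apply/funext => i; rewrite /EI /fs /= ffunE.
pose T s := eval_list a (map Ev (take k s)) * eval_list b (map Ev (drop k s)) *
  h (map Ev s).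
transitivity (\sum_(I : {ffun 'I_(k + m) -> 'I_n})
  T [seq val (I b) | b <- enum 'I_(k + m)]).
  apply: eq_bigr => I _; congr (_ * _); last by rewrite -map_comp.
  have nthI (j : 'I_(k + m)) :
      nth 0 (map Ev [seq val (I b) | b <- enum 'I_(k + m)]) j = Ev (I j).
    by rewrite -map_comp (nth_map j) ?size_enum_ord // nth_ord_enum.
  rewrite map_take map_drop /G /eval_list; congr (a _ * b _); apply/funext => i.
    by rewrite nth_take // (nthI (lshift m i)).
  by rewrite nth_drop (nthI (rshift k i)).
rewrite nsum_ffun nsum_cat /T; apply: eq_nsum => J sJ _; apply: eq_nsum => K _ _.
by rewrite take_size_cat // drop_size_cat // map_cat.
Qed.

Lemma wedge_multilinear k m (a : kcov R n k) (b : kcov R n m) :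
  multilinear a -> multilinear b -> multilinear (wedge a b).
Proof.
move=> aL bL v i c u w; rewrite /wedge !mulr_sumr -big_split /=.
apply: eq_bigr => s _; set j := (s^-1)%g i.
have upd x p : [eta v with i |-> x] (s p) = if p == j then x else v (s p).
  by rewrite /= /j -{1}[i](permKV s) (inj_eq perm_inj).
case: (split_ordP j) => l ->{} in upd *.
  have ua x : a (fun p => [eta v with i |-> x] (s (lshift m p))) =
      a [eta (fun p => v (s (lshift m p))) with l |-> x].
    by congr a; apply/funext => p; rewrite upd (inj_eq (@lshift_inj _ _)).
  have ub x : b (fun p => [eta v with i |-> x] (s (rshift k p))) =
      b (fun p => v (s (rshift k p))).
    congr b; apply/funext => p; rewrite upd -val_eqE /=.
    by rewrite gtn_eqF // ltn_addr.
  rewrite !ua !ub aL.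
  have arr (q t x y z : R) : q * (t * (c * x + y) * z) =
    c * (q * (t * x * z)) + q * (t * y * z) by ring.
  exact: arr.
have ub x : b (fun p => [eta v with i |-> x] (s (rshift k p))) =
    b [eta (fun p => v (s (rshift k p))) with l |-> x].
  by congr b; apply/funext => p; rewrite upd (inj_eq (@rshift_inj _ _)).
have ua x : a (fun p => [eta v with i |-> x] (s (lshift m p))) =
    a (fun p => v (s (lshift m p))).
  congr a; apply/funext => p; rewrite upd -val_eqE /=.
  by rewrite ltn_eqF // ltn_addr.
rewrite !ua !ub bL.
have arr (q t x y z : R) : q * (t * z * (c * x + y)) =
  c * (q * (t * z * x)) + q * (t * z * y) by ring.
exact: arr.
Qed.

End Frames.

(** A coframe has a dual frame: its matrix in the standard basis is
    invertible. *)
Lemma dual_bases_exist (R : realType) n (e : nat -> 'rV[R]_n -> R) :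
  (forall a, (a < n)%N -> forall (c : R) (u v : 'rV[R]_n),
    e a (c *: u + v) = c * e a u + e a v) ->
  (forall v, (forall a, (a < n)%N -> e a v = 0) -> v = 0) ->
  exists Ev, dual_bases e Ev.
Proof.
move=> eL e0.
pose C : 'M[R]_n := \matrix_(j, a) e a (delta_mx 0 j).
have eC (a : 'I_n) v : e a v = (v *m C) 0 a.
  have ea0 : e a 0 = 0.
    have := @eL a (ltn_ord a) 1 0 0; rewrite scaler0 addr0 mul1r => /eqP.
    by rewrite -subr_eq subrr eq_sym => /eqP.
  rewrite {1}[v]row_sum_delta mxE.
  elim/big_rec2: _ => [//|i x y _ <-]; by rewrite eL // mxE.
have Cu : C \in unitmx.
  rewrite -row_free_unit -kermx_eq0; apply/eqP/row_matrixP => i; rewrite row0.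
  apply: e0 => a an; rewrite (eC (Ordinal an)) -row_mul mulmx_ker.
  by rewrite row0 mxE.
pose Ev a := if insub a is Some i then row i (invmx C) else 0.
have EvE (i : 'I_n) : Ev i = row i (invmx C) by rewrite /Ev valK.
exists Ev; split=> // [a b an bn|v].
  rewrite (eC (Ordinal an)) (EvE (Ordinal bn)) -row_mul mulVmx // !mxE.
  by rewrite -val_eqE /= eq_sym.
transitivity (v *m C *m invmx C); first by rewrite -mulmxA mulmxV // mulmx1.
rewrite mulmx_sum_row; apply: eq_bigr => a _.
by rewrite eC EvE.
Qed.

(** * Self-duality of the fundamental form *)

(** Removes the entries of I one by one from s, with the parity of the number
    of transpositions that bring them to the front; None when one of them is
    missing. *)
Fixpoint strip (I s : seq nat) : option (bool * seq nat) :=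
  if I is p :: I' then
    if p \in s then
      if strip I' (rem p s) is Some q then Some (odd (index p s) (+) q.1, q.2)
      else None
    else None
  else Some (false, s).

(** Evaluating a product of coframe elements on frame vectors removes the
    corresponding factors. *)
Lemma wdet_strip (R : realType) n (e : nat -> 'rV[R]_n -> R) Ev I s vs :
  dual_bases e Ev -> uniq s -> all (ltn^~ n) s -> all (ltn^~ n) I ->
  wdet (map Ev I ++ vs) (map e s) =
  if strip I s is Some q then (-1) ^+ q.1 * wdet vs (map e q.2) else 0.
Proof.
move=> eEv; elim: I s => [|p I IH] s us sn; first by rewrite /= mul1r.
move=> /= /andP[pn In]; rewrite size_map.
have eE i : (i < size s)%N ->
    nth (fun=> 0) (map e s) i (Ev p) = (nth 0%N s i == p)%:R.
  move=> si; rewrite (nth_map 0%N) //; case: eEv => _ -> //.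
  by apply: (allP sn); rewrite mem_nth.
have [ps|ps] := boolP (p \in s); last first.
  rewrite big1 // => i _; rewrite eE //.
  case: eqP => [ep|_]; last by rewrite mulr0 mul0r.
  by rewrite -ep mem_nth in ps.
have ip : (index p s < size s)%N by rewrite index_mem.
rewrite (bigD1 (Ordinal ip)) //= eE // nth_index // eqxx mulr1.
rewrite big1 ?addr0 => [|i]; last first.
  rewrite -val_eqE /= => ii; rewrite eE //.
  case: eqP => [ep|_]; last by rewrite mulr0 mul0r.
  by case/negP: ii; rewrite -ep index_uniq.
have -> : del (index p s) (map e s) = map e (rem p s).
  by rewrite remE /del map_cat map_take map_drop.
rewrite IH ?rem_uniq //; last by apply/allP => x /mem_rem; exact: (allP sn).
case: strip => [[b t]|] /=; last by rewrite mulr0.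
by rewrite mulrA signr_addb signr_odd.
Qed.

(** The monomials of the model form, with the parity of their coefficients. *)
Definition spin7_terms : seq (bool * seq nat) :=
  [:: (false, [:: 0; 1; 2; 3]); (false, [:: 0; 1; 4; 5]);
      (false, [:: 0; 1; 6; 7]); (false, [:: 0; 2; 4; 6]);
      (true, [:: 0; 2; 5; 7]); (true, [:: 0; 3; 4; 7]);
      (true, [:: 0; 3; 5; 6]); (false, [:: 4; 5; 6; 7]);
      (false, [:: 2; 3; 6; 7]); (false, [:: 2; 3; 4; 5]);
      (false, [:: 1; 3; 5; 7]); (true, [:: 1; 3; 4; 6]);
      (true, [:: 1; 2; 4; 7]); (true, [:: 1; 2; 5; 6])]%N.

Lemma spin7_modelE (R : realType) (e : nat -> 'rV[R]_8 -> R) vs : size vs = 4%N ->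
  eval_list (spin7_model e) vs =
  \sum_(t <- spin7_terms) (-1) ^+ t.1 * wdet vs (map e t.2).
Proof.
move=> s4; rewrite /eval_list /spin7_model !big_cons big_nil.
have w4 a b c d : wedge4 e a b c d (fun i : 'I_4 => nth 0 vs i) =
    wdet vs [:: e a; e b; e c; e d].
  by rewrite -wedge_seq_wdet.
rewrite !w4 /=; ring.
Qed.

Section SelfDual.
Context {R : realType}.
Local Notation E := 'rV[R]_8.
Variables (e : nat -> E -> R) (Ev : nat -> E).
Hypothesis eEv : dual_bases e Ev.
Variables (F Vol : seq E -> R) (g : E -> E -> R).
Hypotheses (FA : altform 4 F) (VA : altform 8 Vol).
Hypothesis FE : forall vs, size vs = 4%N ->
  F vs = \sum_(t <- spin7_terms) (-1) ^+ t.1 * wdet vs (map e t.2).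
Hypothesis VE : forall vs, size vs = 8%N ->
  Vol vs = wdet vs (map e (iota 0 8)).
Hypothesis gE : forall u v, g u v = \sum_(a < 8) e a u * e a v.

(** Contracting the volume form with e_abcd leaves, up to the sign, the product of
    the four other coframe elements; complementation permutes the 14 monomials of
    Phi and respects their signs. The factor 24 = 4! comes from the sum over
    ordered quadruples. *)
Lemma self_dual W : size W = 4%N ->
  nsum 8 4 (fun I => F (map Ev I) * Vol (map Ev I ++ W)) = 24%:R * F W.
Proof.
move=> s4.
transitivity (\sum_(t <- spin7_terms) (-1) ^+ t.1 *
    (4`!%:R * Vol (map Ev t.2 ++ W))).
  under eq_nsum => I sI _ do rewrite FE ?size_map // mulr_suml.
  rewrite nsum_sum; apply: eq_big_seq => t tT.
  have [st tn] : size t.2 = 4%N /\ all (ltn^~ 8) t.2.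
    have /allP/(_ t tT)/andP[/eqP ? ?] : all (fun t =>
      (size t.2 == 4%N) && all (ltn^~ 8) t.2) spin7_terms by [].
    by [].
  rewrite -(wdet_contract eEv (f := fun s => Vol (s ++ W))) //.
    by rewrite -nsumZl; apply: eq_nsum => I _ _; rewrite mulrA.
  by apply: (@altform_ctx _ _ 4 Vol [::] W); rewrite /= s4.
transitivity (24%:R * \sum_(t <- spin7_terms) (-1) ^+ t.1 *
    (if strip t.2 (iota 0 8) is Some q
     then (-1) ^+ q.1 * wdet W (map e q.2) else 0)).
  rewrite mulr_sumr; apply: eq_big_seq => t tT.
  have /allP/(_ t tT)/andP[/eqP st tn] : all (fun t =>
    (size t.2 == 4%N) && all (ltn^~ 8) t.2) spin7_terms by [].
  rewrite VE ?size_cat ?size_map ?st ?s4 // (wdet_strip _ eEv) //.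
  by rewrite mulrCA.
by rewrite FE //; congr (_ * _); rewrite !big_cons !big_nil /=; ring.
Qed.

(** Since every e_c /\ vol vanishes, contracting v with the form Phi can be traded
    for contracting it with the five other arguments of vol; then self-duality
    applies. *)
Lemma self_dual_contract v u : size u = 5%N ->
  nsum 8 3 (fun J => F (v :: map Ev J) * Vol (map Ev J ++ u)) =
  - (6%:R * \sum_(j < 5) (-1) ^+ j * g v (nth 0 u j) * F (del j u)).
Proof.
move=> s5; set S := nsum _ _ _.
(* The 9-form v^b /\ vol, where v^b = g(v, _), vanishes in dimension 8. *)
have nine us : size us = 9%N ->
    \sum_(i < 9) (-1) ^+ i * g v (nth 0 us i) * Vol (del i us) = 0.
  move=> s9.
  transitivity (\sum_(c < 8) e c v * \sum_(i < size us) (-1) ^+ i *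
      e c (nth 0 us i) * wdet (del i us) (map e (iota 0 8))).
    rewrite s9; under [in RHS]eq_bigr => c _ do rewrite mulr_sumr.
    rewrite exchange_big /=; apply: eq_bigr => i _.
    rewrite gE VE ?size_del ?s9 // mulr_sumr mulr_suml.
    by apply: eq_bigr => c _; ring.
  rewrite big1 // => c _; rewrite wdet_repeated ?mulr0 //.
  by exists c; rewrite ?size_map // (nth_map 0%N) ?nth_iota.
have : nsum 8 4 (fun I => F (map Ev I) * \sum_(i < 4 + 5) (-1) ^+ i *
    g v (nth 0 (map Ev I ++ u) i) * Vol (del i (map Ev I ++ u))) = 0.
  by apply: nsum0 => I sI _; rewrite nine ?mulr0 // size_cat size_map sI s5.
under eq_nsum => I _ _ do rewrite big_split_ord mulrDr !mulr_sumr.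
rewrite nsumD !nsum_sum /=.
(* The four terms where v^b meets an argument of Phi are equal. *)
have left (i : 'I_4) : nsum 8 4 (fun I => F (map Ev I) * ((-1) ^+ i *
    g v (nth 0 (map Ev I ++ u) i) * Vol (del i (map Ev I ++ u)))) = S.
  pose T a J := g v (Ev a) * (F (Ev a :: map Ev J) * Vol (map Ev J ++ u)).
  transitivity (nsum 8 4 (fun I => T (nth 0%N I i) (del i I))).
    apply: eq_nsum => I sI _.
    have := @altform_front _ _ _ F 0 i (map Ev I) [::] FA.
    rewrite !cats0 size_map sI addn0 => /(_ erefl (ltn_ord i)) ->.
    have -> : del i (map Ev I ++ u) = map Ev (del i I) ++ u.
      rewrite /del take_cat drop_cat size_map sI ltn_ord.
      rewrite map_cat map_take map_drop -catA; case: ltnP => // i3.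
      rewrite [drop _ (map _ _)]drop_oversize ?size_map ?sI //.
      have -> : i.+1 = 4%N by move: i3 (ltn_ord i); clear; lia.
      by rewrite subnn drop0.
    rewrite nth_cat size_map sI ltn_ord (nth_map 0%N) ?sI //.
    rewrite {1}/del -map_take -map_drop -map_cat -/(del i I).
    have arr (q x y z : R) : q * x * (q * y * z) = q ^+ 2 * (y * (x * z)) by ring.
    by rewrite arr sqrr_sign mul1r.
  rewrite (nsum_del 8 T (leq_ord i)) -nsum_sum; apply: eq_nsum => J sJ _; rewrite /T.
  rewrite (frame_expand eEv (l := [::]) v (proj1 FA)) /= ?size_map ?sJ //.
  rewrite mulr_suml; apply: eq_bigr => a _; rewrite gE (bigD1 a) //= big1 => [|b ba].
    by case: eEv => _ -> // _; rewrite eqxx mulr1 addr0 mulrA.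
  by case: eEv => _ -> // _; rewrite -val_eqE in ba; rewrite (negPf ba) mulr0.
have right (j : 'I_5) : nsum 8 4 (fun I => F (map Ev I) * ((-1) ^+ (4 + j) *
    g v (nth 0 (map Ev I ++ u) (4 + j)) * Vol (del (4 + j) (map Ev I ++ u)))) =
    24%:R * ((-1) ^+ j * g v (nth 0 u j) * F (del j u)).
  rewrite mulrCA -self_dual ?size_del ?s5 // -nsumZl.
  apply: eq_nsum => I sI _.
  rewrite nth_cat size_map sI ltnNge leq_addr addKn exprD.
  have -> : del (4 + j) (map Ev I ++ u) = map Ev I ++ del j u.
    rewrite /del take_cat drop_cat size_map sI -addnS !ltnNge !leq_addr /=.
    by rewrite !addKn catA.
  ring.
rewrite (eq_bigr (fun=> S)); last by move=> i _; exact: left.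
rewrite [X in _ + X](eq_bigr (fun j : 'I_5 =>
  24%:R * ((-1) ^+ j * g v (nth 0 u j) * F (del j u)))); last first.
  by move=> j _; exact: right.
rewrite sumr_const card_ord -mulr_sumr -[S *+ 4]mulr_natl.
set X := \sum_(j < 5) _; move=> h; lra.
Qed.

End SelfDual.

(** * The codifferential of the fundamental form *)

(** Against an alternating form, the alternation of G contributes as many
    times G as it has terms. *)
Lemma nsum_alternation (R : realType) n (Ev : nat -> 'rV[R]_n) k
    (G : nat -> seq nat -> R) (f : seq 'rV[R]_n -> R) : altform k.+1 f ->
  nsum n k.+1 (fun I => (\sum_(i < k.+1) (-1) ^+ i * G (nth 0%N I i) (del i I)) *
    f (map Ev I)) =
  k.+1%:R * \sum_(a < n) nsum n k (fun J => G a J * f (Ev a :: map Ev J)).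
Proof.
move=> fA.
under eq_nsum => I _ _ do rewrite mulr_suml.
rewrite nsum_sum.
transitivity (\sum_(i < k.+1) \sum_(a < n)
    nsum n k (fun J => G a J * f (Ev a :: map Ev J))); last first.
  by rewrite sumr_const card_ord -[LHS]mulr_natl.
apply: eq_bigr => i _.
rewrite -(nsum_del n (fun a J => G a J * f (Ev a :: map Ev J)) (leq_ord i)).
apply: eq_nsum => I sI _.
have := @altform_front _ _ _ f 0 i (map Ev I) [::] fA.
rewrite !cats0 size_map sI addn0 => /(_ erefl (ltn_ord i)) ->.
rewrite (nth_map 0%N) ?sI // {2}/del -map_take -map_drop -map_cat -/(del i I).
have arr (q x y : R) : q * x * (q * y) = q ^+ 2 * (x * y) by ring.
by rewrite arr sqrr_sign mul1r.
Qed.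

Section Codifferential.
Context {R : realType}.
Local Notation E := 'rV[R]_8.
Variables (e : nat -> E -> R) (Ev : nat -> E).
Hypothesis eEv : dual_bases e Ev.
Variables (F Vol : seq E -> R) (g : E -> E -> R).
Hypotheses (FA : altform 4 F) (VA : altform 8 Vol).
Hypothesis FE : forall vs, size vs = 4%N ->
  F vs = \sum_(t <- spin7_terms) (-1) ^+ t.1 * wdet vs (map e t.2).
Hypothesis VE : forall vs, size vs = 8%N ->
  Vol vs = wdet vs (map e (iota 0 8)).
Hypothesis gE : forall u v, g u v = \sum_(a < 8) e a u * e a v.

Lemma metric_frame (b : 'I_8) v : g (Ev b) v = e b v.
Proof.
rewrite gE (bigD1 b) //= big1 => [|c cb].
  by case: eEv => _ -> // _; rewrite eqxx mul1r addr0.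
by case: eEv => _ -> // _; rewrite -val_eqE in cb; rewrite (negPf cb) mul0r.
Qed.

(** The left-hand side is, up to the factor 5!, the Hodge dual of the exterior
    derivative of Phi when N(u, v) is the derivative of the argument v in the
    direction u. All 5 * 4 terms of the alternation contribute equally, and the
    remaining three slots are contracted by [self_dual_contract]. *)
Lemma dual_alternation (N : E -> E -> E) W : size W = 3%N ->
  nsum 8 5 (fun I => (\sum_(i < 5) (-1) ^+ i *
    \sum_(s < 4) (-1) ^+ s * F (N (nth 0 (map Ev I) i)
       (nth 0 (del i (map Ev I)) s) :: del s (del i (map Ev I)))) *
     Vol (map Ev I ++ W)) =
  - (120%:R * \sum_(a < 8) \sum_(b < 8) \sum_(j < 5) (-1) ^+ j *
     g (N (Ev a) (Ev b)) (nth 0 [:: Ev a, Ev b & W] j) *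
     F (del j [:: Ev a, Ev b & W])).
Proof.
move=> s3.
have del_map i (I : seq nat) : del i (map Ev I) = map Ev (del i I).
  by rewrite /del map_cat map_take map_drop.
pose H a b J := F (N (Ev a) (Ev b) :: map Ev J).
pose G a J := \sum_(s < 4) (-1) ^+ s * H a (nth 0%N J s) (del s J).
transitivity (nsum 8 5 (fun I => (\sum_(i < 5) (-1) ^+ i *
    G (nth 0%N I i) (del i I)) * Vol (map Ev I ++ W))).
  apply: eq_nsum => I sI _; congr (_ * _); apply: eq_bigr => i _; congr (_ * _).
  apply: eq_bigr => s _; congr (_ * _); rewrite !del_map /H.
  by rewrite !(nth_map 0%N) ?size_del ?sI.
have VW : altform 5 (fun s => Vol (s ++ W)).
  by apply: (@altform_ctx _ _ 5 Vol [::] W); rewrite /= s3.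
apply: etrans (nsum_alternation Ev G VW) _.
transitivity (5%:R * \sum_(a < 8) (4%:R * \sum_(b < 8) nsum 8 3 (fun J =>
    H a b J * Vol (Ev a :: Ev b :: map Ev J ++ W)))).
  congr (_ * _); apply: eq_bigr => a _.
  have VaW : altform 4 (fun s => Vol (Ev a :: s ++ W)).
    by apply: (@altform_ctx _ _ 4 Vol [:: Ev a] W); rewrite /= s3.
  exact: (nsum_alternation Ev (H a) VaW).
rewrite -mulr_sumr mulrA -natrM (_ : (5 * 4 = 20)%N) // -mulNr !mulr_sumr.
apply: eq_bigr => a _.
rewrite !mulr_sumr; apply: eq_bigr => b _.
have eq := self_dual_contract eEv FA VA FE VE gE (N (Ev a) (Ev b))
  (u := [:: Ev a, Ev b & W]) (congr1 (fun m => m.+2) s3).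
transitivity (20%:R * nsum 8 3 (fun J => F (N (Ev a) (Ev b) :: map Ev J) *
    Vol (map Ev J ++ [:: Ev a, Ev b & W]))).
  congr (_ * _); apply: eq_nsum => J sJ _; congr (_ * _).
  have := @altform_move_block _ _ _ Vol [::] [:: Ev a; Ev b] (map Ev J) W VA.
  by rewrite /= size_map sJ s3 => /(_ erefl) ->; rewrite -signr_odd expr0 mul1r.
by rewrite eq; ring.
Qed.

Variables (Gam A N : E -> E -> E).
Hypothesis GamC : forall u v, Gam u v = Gam v u.
Hypothesis Askew : forall u v w, g (A u v) w = - g v (A u w).
Hypothesis NE : forall u v, N u v = Gam u v + A u v.

(** The derivative at the identity of the pullback of forms by linear maps, in the
    direction C. *)
Definition endo_act (C : E -> E) (l : seq E) : R :=
  F [:: C (nth 0 l 0); nth 0 l 1; nth 0 l 2; nth 0 l 3] +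
  F [:: nth 0 l 0; C (nth 0 l 1); nth 0 l 2; nth 0 l 3] +
  F [:: nth 0 l 0; nth 0 l 1; C (nth 0 l 2); nth 0 l 3] +
  F [:: nth 0 l 0; nth 0 l 1; nth 0 l 2; C (nth 0 l 3)].

(** The symmetric part Gam of N drops out against the alternating forms, and each
    sum over b is turned by the skewness of A into an argument of Phi. *)
Lemma divergence_form w0 w1 w2 :
  \sum_(a < 8) \sum_(b < 8) \sum_(j < 5) (-1) ^+ j *
     g (N (Ev a) (Ev b)) (nth 0 [:: Ev a; Ev b; w0; w1; w2] j) *
     F (del j [:: Ev a; Ev b; w0; w1; w2]) =
  - \sum_(a < 8) endo_act (A (Ev a)) [:: Ev a; w0; w1; w2].
Proof.
have gC u v : g u v = g v u by rewrite !gE; apply: eq_bigr => c _; rewrite mulrC.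
have gD u v w : g (u + v) w = g u w + g v w.
  rewrite !gE -big_split; apply: eq_bigr => c _ /=; case: eEv => eL _ _.
  by rewrite -[u in u + v]scale1r eL // mul1r mulrDl.
have swap01 u v w z : F [:: u; v; w; z] = - F [:: v; u; w; z].
  exact: (altform_swap (l := [::]) _ _ FA).
have swap12 u v w z : F [:: u; v; w; z] = - F [:: u; w; v; z].
  exact: (altform_swap (l := [:: u]) _ _ FA).
have swap23 u v w z : F [:: u; v; w; z] = - F [:: u; v; z; w].
  exact: (altform_swap (l := [:: u; v]) _ _ FA).
pose X (M : E -> E -> E) a b :=
  g (M (Ev a) (Ev b)) (Ev a) * F [:: Ev b; w0; w1; w2] -
  g (M (Ev a) (Ev b)) (Ev b) * F [:: Ev a; w0; w1; w2] +
  g (M (Ev a) (Ev b)) w0 * F [:: Ev a; Ev b; w1; w2] -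
  g (M (Ev a) (Ev b)) w1 * F [:: Ev a; Ev b; w0; w2] +
  g (M (Ev a) (Ev b)) w2 * F [:: Ev a; Ev b; w0; w1].
transitivity (\sum_(a < 8) \sum_(b < 8) (X Gam a b + X A a b)).
  apply: eq_bigr => a _; apply: eq_bigr => b _.
  rewrite !big_ord_recl big_ord0 /= /del /= NE !gD /X.
  rewrite /bump /= !addn1 /= !exprS expr0; ring.
transitivity (\sum_(a < 8) \sum_(b < 8) X Gam a b +
    \sum_(a < 8) \sum_(b < 8) X A a b).
  by rewrite -big_split; apply: eq_bigr => a _; rewrite big_split.
have -> : \sum_(a < 8) \sum_(b < 8) X Gam a b = 0.
  have XN (a b : 'I_8) : X Gam a b = - X Gam b a.
    rewrite /X [Gam (Ev b) _]GamC.
    rewrite [F [:: Ev b; Ev a; w1; w2]]swap01 [F [:: Ev b; Ev a; w0; w2]]swap01.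
    rewrite [F [:: Ev b; Ev a; w0; w1]]swap01; ring.
  set S := \sum_(a < 8) _; have : S = - S.
    rewrite {1}/S exchange_big -sumrN; apply: eq_bigr => a _ /=.
    by rewrite -sumrN; apply: eq_bigr => b _; exact: XN.
  move=> h; lra.
rewrite add0r -sumrN; apply: eq_bigr => a _.
have contr l r v : (size l + size r).+1 = 4%N ->
    \sum_(b < 8) g (A (Ev a) (Ev b)) v * F (l ++ Ev b :: r) =
    - F (l ++ A (Ev a) v :: r).
  move=> s; rewrite (frame_expand eEv (k := 4)) //; last by case: FA.
  rewrite -sumrN; apply: eq_bigr => b _.
  by rewrite Askew metric_frame mulNr.
have diag b : g (A (Ev a) (Ev b)) (Ev b) = 0.
  have := Askew (Ev a) (Ev b) (Ev b); rewrite [X in _ = - X]gC => h; lra.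
have diag0 : \sum_(b < 8) g (A (Ev a) (Ev b)) (Ev b) * F [:: Ev a; w0; w1; w2] = 0.
  by rewrite big1 // => b _; rewrite diag mul0r.
rewrite /X !big_split /= !sumrN diag0.
rewrite (contr [::] [:: w0; w1; w2]) // (contr [:: Ev a] [:: w1; w2]) //.
rewrite (contr [:: Ev a] [:: w0; w2]) // (contr [:: Ev a] [:: w0; w1]) //.
rewrite /endo_act /=.
rewrite [F [:: Ev a; w0; _; w2]]swap12 [F [:: Ev a; w0; w1; A _ _]]swap23.
rewrite [F [:: Ev a; w0; A _ _; w1]]swap12; ring.
Qed.

(** Since Phi is self-dual, the Hodge dual of d /\ Phi is a contraction of d
    with Phi. *)
Lemma dual_wedge (d : kcov R 8 3) (Phi : kcov R 8 4) z :
  (forall vs, eval_list Phi vs = F vs) ->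
  nsum 8 7 (fun I => eval_list (wedge d Phi) (map Ev I) * Vol (map Ev I ++ [:: z])) =
  7`!%:R * (6%:R^-1 *
    nsum 8 3 (fun J => eval_list d (map Ev J) * F (map Ev J ++ [:: z]))).
Proof.
move=> PF.
have Vz : altform (3 + 4) (fun s => Vol (s ++ [:: z])).
  exact: (@altform_ctx _ _ 7 Vol [::] [:: z]).
apply: etrans (nsum_wedge Ev d Phi Vz) _; congr (_ * _).
have -> : ((3`! * 4`!)%:R^-1 : R) = 6%:R^-1 * 24%:R^-1 by rewrite natrM invfM.
rewrite -mulrA; congr (_ * _); rewrite -nsumZl; apply: eq_nsum => J sJ _.
transitivity (24%:R^-1 * (eval_list d (map Ev J) * nsum 8 4 (fun K => F (map Ev K) *
    Vol (map Ev K ++ (map Ev J ++ [:: z]))))).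
  congr (_ * _); rewrite -nsumZl; apply: eq_nsum => K sK _.
  rewrite PF -mulrA; congr (_ * (_ * _)).
  have := @altform_move_block _ _ _ Vol [::] (map Ev J) (map Ev K) [:: z] VA.
  rewrite /= !size_map sJ sK => /(_ erefl); rewrite catA => ->.
  by rewrite -signr_odd expr0 mul1r.
rewrite (self_dual eEv VA FE VE) ?size_cat ?size_map ?sJ //.
by rewrite mulrCA mulKf // pnatr_eq0.
Qed.

End Codifferential.

(** * Components of alternating forms *)

Fixpoint insert_sign (a : nat) (s : seq nat) : bool * seq nat :=
  if s is b :: s' then
    if (a < b)%N then (false, a :: s)
    else let q := insert_sign a s' in (~~ q.1, b :: q.2)
  else (false, [:: a]).

(** Insertion sort, with the parity of the sorting permutation. *)
Fixpoint sort_sign (s : seq nat) : bool * seq nat :=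
  if s is a :: s' then
    let q := sort_sign s' in let t := insert_sign a q.2 in (q.1 (+) t.1, t.2)
  else (false, [::]).

Lemma perm_insert_sign a s : perm_eq (insert_sign a s).2 (a :: s).
Proof.
elim: s => //= b s IH; case: ifP => //= _.
rewrite (perm_trans _ (_ : perm_eq (b :: a :: s) _)) ?perm_cons //.
exact/permPl/(perm_catCA [:: b] [:: a] s).
Qed.

Lemma perm_sort_sign s : perm_eq (sort_sign s).2 s.
Proof.
elim: s => //= a s IH; apply: perm_trans (perm_insert_sign _ _) _.
by rewrite perm_cons.
Qed.

Lemma sort_sign_sorted s : sorted leq (sort_sign s).2.
Proof.
elim: s => //= a s; elim: (sort_sign s).2 => //= b t IH st.
case: ltnP => ab /=; first by rewrite (ltnW ab).
rewrite (path_min_sorted _) ?IH ?(path_sorted st) //.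
rewrite (perm_all _ (perm_insert_sign _ _)) /= ab.
exact: (order_path_min leq_trans st).
Qed.

Section Components.
Context {R : realType} {V : lmodType R}.
Variables (Ev : nat -> V) (k : nat) (f : seq V -> R).
Hypothesis fA : altform k f.

Lemma altform_sort_sign I : size I = k ->
  f (map Ev I) = (-1) ^+ (sort_sign I).1 * f (map Ev (sort_sign I).2).
Proof.
have ins l a s : (size l + size s).+1 = k -> f (l ++ map Ev (a :: s)) =
    (-1) ^+ (insert_sign a s).1 * f (l ++ map Ev (insert_sign a s).2).
  elim: s l => [|b s IH] l /= sz; first by rewrite mul1r.
  case: ifP => _ /=; first by rewrite mul1r.
  rewrite (altform_swap _ _ fA) ?size_map -?sz; last by lia.
  rewrite -cat_rcons IH ?size_rcons -?sz; last by lia.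
  by rewrite cat_rcons signrN mulNr.
suff gen l : (size l + size I)%N = k -> f (l ++ map Ev I) =
    (-1) ^+ (sort_sign I).1 * f (l ++ map Ev (sort_sign I).2) by exact: (gen [::]).
elim: I l => [|a I IH] l sz; first by rewrite mul1r.
rewrite /= -cat_rcons IH ?size_rcons -?sz /=; last by lia.
rewrite cat_rcons ins ?(perm_size (perm_sort_sign _)) -?sz //=; last by rewrite addnS.
by rewrite mulrA signr_addb.
Qed.

Lemma altform_not_uniq I : size I = k -> ~~ uniq I -> f (map Ev I) = 0.
Proof.
move=> sI /(uniqPn 0%N)[i [j [ij jI eij]]].
have -> : I = take i I ++ nth 0%N I i :: take (j - i).-1 (drop i.+1 I) ++
    nth 0%N I i :: drop j.+1 I.
  rewrite -{1}(cat_take_drop i I) (drop_nth 0%N) ?(ltn_trans ij) //.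
  congr (_ ++ _ :: _); rewrite -{1}(cat_take_drop (j - i).-1 (drop i.+1 I)).
  rewrite drop_drop eij -drop_nth //; congr (_ ++ drop _ _).
  by move: ij; clear; lia.
rewrite map_cat /= map_cat /= (altform_dup _ fA) //.
have -> : size (map Ev (take i I)) = i.
  by rewrite size_map size_takel // ltnW // (ltn_trans ij).
have -> : size (map Ev (take (j - i).-1 (drop i.+1 I))) = (j - i).-1.
  by rewrite size_map size_takel // size_drop; move: (size I) ij jI; clear; lia.
by rewrite size_map size_drop; move: (size I) ij jI sI; clear; lia.
Qed.

End Components.

Fixpoint words (n k : nat) : seq (seq nat) :=
  if k is k'.+1 then [seq a :: s | a <- iota 0 n, s <- words n k'] else [:: [::]].

Lemma mem_words n k I : size I = k -> all (ltn^~ n) I -> I \in words n k.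
Proof.
elim: k I => [|k IH] [|a I] //= [sI] /andP[an nI].
by apply/allpairsP; exists (a, I); rewrite mem_iota IH.
Qed.

Lemma frame_eq0 (R : realType) n (e : nat -> 'rV[R]_n -> R) Ev k f :
  dual_bases e Ev -> slot_linear k f ->
  (forall I, size I = k -> all (ltn^~ n) I -> f (map Ev I) = 0) ->
  forall l, size l = k -> f l = 0.
Proof.
move=> eEv fL f0 l.
suff gen I : (size I + size l)%N = k -> all (ltn^~ n) I ->
    f (map Ev I ++ l) = 0 by move=> sl; apply: (gen [::]).
elim: l I => [|v l IH] I sz In.
  by rewrite cats0 f0 // -sz addn0.
rewrite (frame_expand eEv _ fL) /= ?size_map -?sz ?addnS //.
rewrite big1 // => a _; rewrite -cat_rcons -map_rcons IH ?mulr0 //.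
  by rewrite size_rcons -sz /= addSnnS.
by rewrite all_rcons In andbT /= ltn_ord.
Qed.

(** * Linear forms with integer coefficients *)

(** Deciding equality of such lists as linear forms reduces the identities between
    components below to computations with integers. *)
Definition lform : Type := seq (int * (nat * nat)).

Definition lscale (z : int) (l : lform) : lform := [seq (z * t.1, t.2) | t <- l].

Definition lcoef (l : lform) (v : nat * nat) : int :=
  foldr (fun t z => if t.2 == v then t.1 + z else z) 0 l.

Definition lzero (l : lform) : bool :=
  all (fun v => lcoef l v == 0) (undup [seq t.2 | t <- l]).

(** Expresses a linear form on skew matrices in the entries x_ij with i < j. *)
Definition lskew (l : lform) : lform :=
  [seq if (t.2.1 < t.2.2)%N then t else (- t.1, (t.2.2, t.2.1))
  | t <- l & t.2.1 != t.2.2].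

Section LinearForms.
Context {R : realType}.
Variable p : nat -> nat -> R.

Definition leval (l : lform) : R := \sum_(t <- l) t.1%:~R * p t.2.1 t.2.2.

Lemma leval_cat l1 l2 : leval (l1 ++ l2) = leval l1 + leval l2.
Proof. exact: big_cat. Qed.

Lemma leval_cons t l : leval (t :: l) = t.1%:~R * p t.2.1 t.2.2 + leval l.
Proof. exact: big_cons. Qed.

Lemma leval_nil : leval [::] = 0. Proof. exact: big_nil. Qed.

Lemma leval_flatten ls : leval (flatten ls) = \sum_(l <- ls) leval l.
Proof.
by elim: ls => [|l ls IH]; rewrite ?big_nil ?leval_nil //= leval_cat big_cons IH.
Qed.

Lemma leval_scale z l : leval (lscale z l) = z%:~R * leval l.
Proof.
rewrite /leval big_map mulr_sumr; apply: eq_bigr => t _ /=.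
by rewrite intrM mulrA.
Qed.

Lemma leval_filter l : leval [seq t <- l | t.1 != 0] = leval l.
Proof.
elim: l => //= t l IH; rewrite leval_cons.
by case: eqP => /= [->|_]; rewrite ?leval_cons ?IH // mul0r add0r.
Qed.

Lemma leval_zero l : lzero l -> leval l = 0.
Proof.
move=> /allP l0; set s := undup _ in l0.
have us : uniq s by exact: undup_uniq.
have ls : {subset [seq t.2 | t <- l] <= s} by move=> v; rewrite mem_undup.
clearbody s.
transitivity (\sum_(v <- s) (lcoef l v)%:~R * p v.1 v.2).
  elim: l ls {l0} => [|t l IH] ls.
    by rewrite leval_nil big1 // => v _; rewrite mul0r.
  rewrite leval_cons IH => [|v vl]; last by apply: ls; rewrite inE vl orbT.
  have ts : t.2 \in s by apply: ls; rewrite inE eqxx.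
  rewrite (bigD1_seq t.2) //= [in RHS](bigD1_seq t.2) //= eqxx intrD mulrDl.
  rewrite -addrA; congr (_ + (_ + _)); apply: eq_bigr => v vt.
  by rewrite eq_sym (negPf vt).
by rewrite big_seq big1 // => v vs; rewrite (eqP (l0 v vs)) mul0r.
Qed.

Lemma leval_skew l : (forall i j, p i j = - p j i) -> leval (lskew l) = leval l.
Proof.
move=> pS; elim: l => //= -[z [i j]] l IH /=; rewrite leval_cons /= -IH /lskew /=.
case: eqP => [->|_] /=; last first.
  rewrite leval_cons /=; case: ifP => //= _.
  by rewrite [in RHS]pS intrN mulNr mulrN.
by have := pS j j => h; rewrite (_ : p j j = 0) ?mulr0 ?add0r //; lra.
Qed.

End LinearForms.

(** * The action of so(8) on the fundamental form *)

(** The components of Phi in an adapted frame. *)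
Definition phi (I : seq nat) : int :=
  foldr (fun t z => if strip I t.2 is Some q
                    then (if t.1 (+) q.1 then -1 else 1) + z else z)
    0 spin7_terms.

(** The component I of C.Phi, as a linear form in the entries of the matrix C. *)
Definition act_lform (I : seq nat) : lform :=
  flatten [seq [seq (phi (set_nth 0%N I s m), (m, nth 0%N I s)) | m <- iota 0 8]
          | s <- iota 0 4].

(** The pairing of a skew matrix with the 2-form e_0r + (contraction of Phi with
    e_0 and e_r). For r = 1, ..., 7 these 2-forms span the orthogonal complement of
    spin(7) in so(8). *)
Definition pi7 (r : nat) : lform :=
  (1, (0%N, r)) :: flatten [seq [seq (phi [:: 0; r; i; j]%N, (i, j))
    | j <- iota 0 8 & (i < j)%N] | i <- iota 0 8].

(** Among the seven forms [pi7], only the r-th involves the entry x_0r; so its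
    coefficient in [act_lform] can be read off there. *)
Definition act_coef (s : seq nat) (r : nat) : int :=
  lcoef (lskew (act_lform s)) (0%N, r).

Lemma act_pi7_check : all (fun s =>
  lzero (lskew (act_lform s) ++
         flatten [seq lscale (- act_coef s r) (pi7 r) | r <- iota 1 7]))
  [seq s <- words 8 4 | sorted ltn s].
Proof. by vm_compute. Qed.

(** The component I of C.Phi, as a combination of the forms [pi7]. *)
Definition act_table (I : seq nat) : seq (int * nat) :=
  if uniq I then
    let q := sort_sign I in
    [seq ((if q.1 then -1 else 1) * act_coef q.2 r, r) | r <- iota 1 7]
  else [::].

(** In this form and the next ones, the variable indexed by (a, r) is the r-th
    component of A_(E_a) along the complement of spin(7). *)
Definition delta_lform (J : seq nat) : lform :=
  [seq t <- flatten [seq [seq (- t.1, (a, t.2)) | t <- act_table (a :: J)]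
                    | a <- iota 0 8] | t.1 != 0].

(** The factor 6 clears the 1/3! in the contraction of delta Phi with Phi. *)
Definition theta6_lform (w : nat) : lform :=
  flatten [seq lscale (phi (rcons J w)) (delta_lform J)
          | J <- words 8 3 & phi (rcons J w) != 0].

(** The matrix B_(E_c), multiplied by 72 = 6 * 12 to clear the denominators. The
    list th of the forms [theta6_lform] is an argument so that it is evaluated only
    once. *)
Definition b72_lform (th : seq lform) (c i m : nat) : lform :=
  lscale 36 (delta_lform [:: c; i; m]) ++
  flatten [seq lscale (- phi [:: c; i; m; w]) (nth [::] th w)
          | w <- iota 0 8 & phi [:: c; i; m; w] != 0].

(** In the linear form for (c, r), the first entry comes from A_(E_c) and the others
    come from B_(E_c). *)
Definition spin7_part_vanishes : bool :=
  let th := [seq theta6_lform w | w <- iota 0 8] in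
  all (fun c => all (fun r =>
    lzero ((72, (c, r)) ::
      flatten [seq lscale t.1 (b72_lform th c t.2.2 t.2.1)
              | t <- pi7 r & t.1 != 0])) (iota 1 7)) (iota 0 8).

Lemma spin7_check : spin7_part_vanishes.
Proof. by vm_compute. Qed.

(* Keeps [/=] from expanding these lists. *)
Local Arguments lscale : simpl never.
Local Arguments pi7 : simpl never.
Local Arguments phi : simpl never.
Local Arguments delta_lform : simpl never.
Local Arguments theta6_lform : simpl never.

Lemma endo_act_linear (R : realType) (F : seq 'rV[R]_8 -> R) c
    (C C1 C2 : 'rV[R]_8 -> 'rV[R]_8) l :
  slot_linear 4 F -> (forall v, C v = c *: C1 v + C2 v) ->
  endo_act F C l = c * endo_act F C1 l + endo_act F C2 l.
Proof.
move=> FL CE; rewrite /endo_act !CE.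
rewrite (FL [::]) // (FL [:: _]) // (FL [:: _; _]) // (FL [:: _; _; _]) //=.
ring.
Qed.

Lemma nsum_words (R : pzRingType) n k (F : seq nat -> R) :
  nsum n k F = \sum_(I <- words n k) F I.
Proof.
elim: k F => [|k IH] F /=; first by rewrite big_seq1.
rewrite big_flatten big_map (_ : iota 0 n = index_iota 0 n) ?big_mkord.
  by apply: eq_bigr => a _; rewrite IH big_map.
by rewrite /index_iota subn0.
Qed.

Section SpinAlgebra.
Context {R : realType}.
Local Notation E := 'rV[R]_8.
Variables (e : nat -> E -> R) (Ev : nat -> E).
Hypothesis eEv : dual_bases e Ev.
Variables (F : seq E -> R) (g : E -> E -> R).
Hypothesis FA : altform 4 F.
Hypothesis FE : forall vs, size vs = 4%N ->
  F vs = \sum_(t <- spin7_terms) (-1) ^+ t.1 * wdet vs (map e t.2).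
Hypothesis gE : forall u v, g u v = \sum_(a < 8) e a u * e a v.

Let big8 (f : nat -> R) : \sum_(a <- iota 0 8) f a = \sum_(a < 8) f a.
Proof. by rewrite -(big_mkord xpredT). Qed.

Let gC u v : g u v = g v u.
Proof. by rewrite !gE; apply: eq_bigr => c _; rewrite mulrC. Qed.

Let gL c u v w : g (c *: u + v) w = c * g u w + g v w.
Proof.
rewrite !gE mulr_sumr -big_split; apply: eq_bigr => a _ /=.
by case: eEv => eL _ _; rewrite eL // mulrDl mulrA.
Qed.

Let g_frame (b : 'I_8) v : g (Ev b) v = e b v.
Proof. exact: (metric_frame eEv gE). Qed.

Lemma phiE I : size I = 4%N -> all (ltn^~ 8) I -> F (map Ev I) = (phi I)%:~R.
Proof.
move=> sI In; rewrite FE ?size_map // /phi.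
have : all (fun t => uniq t.2 && all (ltn^~ 8) t.2) spin7_terms by [].
elim: spin7_terms => [_|t ts IH] /=; first by rewrite big_nil.
move=> /andP[/andP[tu tn] tsP]; rewrite big_cons IH //.
rewrite -[map Ev I]cats0 (wdet_strip _ eEv) //.
case: strip => [[b s]|] /=; last by rewrite mulr0 add0r.
rewrite mulr1 -signr_addb intrD; congr (_ + _).
by case: (t.1 (+) b); rewrite /= ?expr1 // mulrN1z.
Qed.

Section Endomorphism.
Variable C : E -> E.
Hypothesis CL : forall c u v, C (c *: u + v) = c *: C u + C v.
Hypothesis CS : forall u v, g (C u) v = - g u (C v).

Let c m i := g (Ev m) (C (Ev i)).

Lemma altform_endo_act : altform 4 (endo_act F C).
Proof.
have [FL F0] := FA.
have sl0 a u w x y z : F [:: a *: u + w; x; y; z] =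
    a * F [:: u; x; y; z] + F [:: w; x; y; z].
  exact: (FL [::] [:: x; y; z]).
have sl1 a u w x y z : F [:: x; a *: u + w; y; z] =
    a * F [:: x; u; y; z] + F [:: x; w; y; z].
  exact: (FL [:: x] [:: y; z]).
have sl2 a u w x y z : F [:: x; y; a *: u + w; z] =
    a * F [:: x; y; u; z] + F [:: x; y; w; z].
  exact: (FL [:: x; y] [:: z]).
have sl3 a u w x y z : F [:: x; y; z; a *: u + w] =
    a * F [:: x; y; z; u] + F [:: x; y; z; w].
  exact: (FL [:: x; y; z] [::]).
have sw01 u v w z : F [:: u; v; w; z] = - F [:: v; u; w; z].
  exact: (altform_swap (l := [::]) _ _ FA).
have sw12 u v w z : F [:: u; v; w; z] = - F [:: u; w; v; z].
  exact: (altform_swap (l := [:: u]) _ _ FA).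
have sw23 u v w z : F [:: u; v; w; z] = - F [:: u; v; z; w].
  exact: (altform_swap (l := [:: u; v]) _ _ FA).
have al0 u w z : F [:: u; u; w; z] = 0 by exact: (F0 [::]).
have al1 u w z : F [:: w; u; u; z] = 0 by exact: (F0 [:: w]).
have al2 u w z : F [:: w; z; u; u] = 0 by exact: (F0 [:: w; z]).
split; rewrite /endo_act.
  move=> [|x [|y [|z [|? l]]]] r b u w sz; last by exfalso; move: sz => /=; lia.
  - case: r sz => [|x [|y [|z [|]]]] //= _.
    by rewrite CL !sl0; ring.
  - case: r sz => [|y [|z [|]]] //= _.
    by rewrite CL !sl1; ring.
  - case: r sz => [|z [|]] //= _.
    by rewrite CL !sl2; ring.
  - case: r sz => [|] //= _.
    by rewrite CL !sl3; ring.
move=> [|x [|y [|z l]]] r u sz; last by exfalso; move: sz => /=; lia.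
- case: r sz => [|x [|y [|]]] //= _.
  by rewrite [F [:: u; C u; _; _]]sw01 !al0; ring.
- case: r sz => [|y [|]] //= _.
  by rewrite [F [:: x; u; C u; _]]sw12 !al1; ring.
- case: r sz => [|] //= _.
  by rewrite [F [:: x; y; u; C u]]sw23 !al2; ring.
Qed.

Lemma act_lformE I : size I = 4%N -> all (ltn^~ 8) I ->
  endo_act F C (map Ev I) = leval c (act_lform I).
Proof.
have slot l i r : (size l + size r).+1 = 4%N -> all (ltn^~ 8) l -> all (ltn^~ 8) r ->
    F (map Ev l ++ C (Ev i) :: map Ev r) =
    \sum_(m <- iota 0 8) (phi (l ++ m :: r))%:~R * c m i.
  move=> sz lP rP; rewrite (frame_expand eEv _ (proj1 FA)) ?size_map //.
  rewrite big8; apply: eq_bigr => m _.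
  rewrite /c g_frame mulrC -phiE ?map_cat // ?size_cat /= -?sz ?addnS //.
  by rewrite all_cat lP /= ltn_ord.
case: I => [|i [|j [|k [|l [|]]]]] //= _ /and5P[iP jP kP lP _].
rewrite /act_lform leval_flatten !big_cons big_nil addr0 /leval !big_map.
rewrite /endo_act /= -!addrA.
congr (_ + (_ + (_ + _))).
- by apply: (slot [::] i [:: j; k; l]) => //=; rewrite jP kP lP.
- by apply: (slot [:: i] j [:: k; l]) => //=; rewrite ?iP ?kP ?lP.
- by apply: (slot [:: i; j] k [:: l]) => //=; rewrite ?iP ?jP ?lP.
- by apply: (slot [:: i; j; k] l [::]) => //=; rewrite iP jP kP.
Qed.

(** By alternation, it is enough to compare the 70 components with increasing
    indices, which is what [act_pi7_check] does. *)
Lemma act_tableE I : size I = 4%N -> all (ltn^~ 8) I ->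
  endo_act F C (map Ev I) =
  \sum_(t <- act_table I) t.1%:~R * leval c (pi7 t.2).
Proof.
move=> sI In; rewrite /act_table.
have cS i j : c i j = - c j i by rewrite /c gC CS gC.
case: ifP => [uI|/negbT nuI]; last first.
  by rewrite big_nil (altform_not_uniq _ altform_endo_act).
rewrite (altform_sort_sign _ altform_endo_act) //.
set s := (sort_sign I).2; have ps : perm_eq s I by exact: perm_sort_sign.
have ss : size s = 4%N by rewrite (perm_size ps).
have sn : all (ltn^~ 8) s by rewrite (perm_all _ ps).
have srt : sorted ltn s.
  by rewrite ltn_sorted_uniq_leq (perm_uniq ps) uI sort_sign_sorted.
have := allP act_pi7_check s; rewrite mem_filter srt mem_words // => /(_ isT).
move=> /(leval_zero c); rewrite leval_cat leval_skew // -act_lformE //.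
rewrite leval_flatten big_map => /eqP; rewrite addr_eq0 => /eqP ->.
rewrite big_map mulrN mulr_sumr -sumrN; apply: eq_bigr => r _ /=.
rewrite leval_scale intrM intrN -/s mulNr mulrN opprK mulrA.
by congr (_ * _ * _); case: (sort_sign I).1; rewrite /= ?expr1 // mulrN1z.
Qed.

Lemma spin7_act_eq0 : (forall r, (0 < r < 8)%N -> leval c (pi7 r) = 0) ->
  forall l, size l = 4%N -> endo_act F C l = 0.
Proof.
move=> c0; apply: (frame_eq0 eEv (proj1 altform_endo_act)) => I sI In.
rewrite act_tableE // big_seq big1 // => t tI; rewrite c0 ?mulr0 //.
move: tI; rewrite /act_table; case: ifP => // _ /mapP[r].
by rewrite mem_iota => r7 -> /=.
Qed.

End Endomorphism.

Variable A : E -> E -> E.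
Hypothesis AL1 : forall c u v w, A (c *: u + v) w = c *: A u w + A v w.
Hypothesis AL2 : forall u c v w, A u (c *: v + w) = c *: A u v + A u w.
Hypothesis AS : forall u v w, g (A u v) w = - g v (A u w).

(** This is delta Phi when A is the connection form, see [codiff_spin7]. *)
Definition divergence (l : seq E) : R :=
  - \sum_(a < 8) endo_act F (A (Ev a)) (Ev a :: l).

(** This is *(delta Phi /\ Phi), a multiple of the Lee form; see
    [hodge_wedge_spin7]. *)
Definition lee_form (z : E) : R :=
  6%:R^-1 * nsum 8 3 (fun J => divergence (map Ev J) * F (map Ev J ++ [:: z])).

Let p a r := leval (fun m i => g (Ev m) (A (Ev a) (Ev i))) (pi7 r).

Lemma delta_lformE J : size J = 3%N -> all (ltn^~ 8) J ->
  divergence (map Ev J) = leval p (delta_lform J).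
Proof.
move=> sJ Jn; rewrite /divergence leval_filter leval_flatten big_map big8 -sumrN.
apply: eq_bigr => a _.
rewrite (act_tableE (AL2 (Ev a)) (AS (Ev a)) (I := nat_of_ord a :: J)) /=; first last.
- by rewrite Jn ltn_ord.
- by rewrite sJ.
rewrite /leval big_map -sumrN; apply: eq_bigr => t _ /=.
by rewrite intrN mulNr.
Qed.

Lemma theta6_lformE w : (w < 8)%N ->
  6%:R * lee_form (Ev w) = leval p (theta6_lform w).
Proof.
move=> w8; rewrite mulVKf ?pnatr_eq0 // nsum_words leval_flatten big_map big_filter.
rewrite big_seq [RHS]big_mkcond [RHS]big_seq; apply: eq_bigr => J JW.
have [sJ Jn] : size J = 3%N /\ all (ltn^~ 8) J.
  have : all (fun J => (size J == 3%N) && all (ltn^~ 8) J) (words 8 3) by vm_compute.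
  by move=> /allP/(_ J JW)/andP[/eqP ? ?].
rewrite delta_lformE // cats1 -map_rcons phiE ?size_rcons ?sJ //; last first.
  by rewrite all_rcons Jn andbT.
by rewrite leval_scale mulrC; case: eqP => [->|//]; rewrite mul0r.
Qed.

Lemma altform_divergence : altform 3 divergence.
Proof.
have T a := altform_endo_act (AL2 (Ev a)).
split=> [l r c u w sz|l r u sz]; rewrite /divergence.
  rewrite mulrN -opprD mulr_sumr -big_split; congr (- _); apply: eq_bigr => a _ /=.
  by apply: ((T a).1 (Ev a :: l)); exact: (congr1 S sz).
rewrite big1 ?oppr0 // => a _.
by apply: ((T a).2 (Ev a :: l)); exact: (congr1 S sz).
Qed.

Lemma lee_form_linear c u v : lee_form (c *: u + v) = c * lee_form u + lee_form v.
Proof.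
rewrite /lee_form [c * _]mulrCA -mulrDr; congr (_ * _); rewrite -nsumZl -nsumD.
apply: eq_nsum => J sJ _; rewrite (proj1 FA) ?size_map ?sJ // mulrDr.
by rewrite mulrCA.
Qed.

Definition vcross u v w : E := \sum_(m < 8) F [:: u; v; w; Ev m] *: Ev m.

(** The form g(B_u v, w). *)
Definition bform u v w : R :=
  2%:R^-1 * divergence [:: u; v; w] - 12%:R^-1 * lee_form (vcross u v w).

Lemma lee_vcross u v w :
  lee_form (vcross u v w) = \sum_(m < 8) F [:: u; v; w; Ev m] * lee_form (Ev m).
Proof.
have l0 : lee_form 0 = 0.
  by have := lee_form_linear 1 0 0; rewrite scaler0 addr0 mul1r => h; lra.
rewrite /vcross; elim/big_rec2: _ => [//|m x y _ <-]; exact: lee_form_linear.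
Qed.

Lemma b72_lformE c i m : (c < 8)%N -> (i < 8)%N -> (m < 8)%N ->
  72%:R * bform (Ev c) (Ev i) (Ev m) =
  leval p (b72_lform [seq theta6_lform w | w <- iota 0 8] c i m).
Proof.
move=> c8 i8 m8; rewrite leval_cat leval_scale -(@delta_lformE [:: c; i; m]) //; last first.
  by rewrite /= c8 i8 m8.
rewrite leval_flatten big_map big_filter /bform lee_vcross.
set th := map theta6_lform _.
have -> : \sum_(w <- iota 0 8 | phi [:: c; i; m; w] != 0)
    leval p (lscale (- phi [:: c; i; m; w]) (nth [::] th w)) =
    - (6%:R * \sum_(w < 8) F [:: Ev c; Ev i; Ev m; Ev w] * lee_form (Ev w)).
  rewrite big_mkcond big8 mulr_sumr -sumrN; apply: eq_bigr => w _ /=.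
  rewrite [F _](@phiE [:: c; i; m; nat_of_ord w]) //=; last by rewrite c8 i8 m8 ltn_ord.
  rewrite leval_scale intrN mulNr mulrCA theta6_lformE //.
  rewrite (nth_map 0%N) ?size_iota // nth_iota // add0n.
  by case: eqP => [->|//]; rewrite mul0r oppr0.
by set X := \sum_(w < 8) _; lra.
Qed.

(** So A_X + B_X lies in spin(7) when X belongs to the frame; the constants 1/2 and
    1/12 in [bform] are the ones that achieve this. *)
Lemma pi7_bform c r : (c < 8)%N -> (0 < r < 8)%N ->
  leval (fun m i => g (Ev m) (A (Ev c) (Ev i)) + bform (Ev c) (Ev i) (Ev m))
    (pi7 r) = 0.
Proof.
move=> c8 r8.
have r17 : r \in iota 1 7 by rewrite mem_iota.
have c07 : c \in iota 0 8 by rewrite mem_iota.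
set th := [seq theta6_lform w | w <- iota 0 8].
have chk : lzero ((72, (c, r)) :: flatten
    [seq lscale t.1 (b72_lform th c t.2.2 t.2.1) | t <- pi7 r & t.1 != 0]).
  exact: (allP (allP spin7_check c c07) r r17).
have h := leval_zero p chk.
rewrite leval_cons leval_flatten big_map big_filter in h.
have lt8 t : t \in pi7 r -> (t.2.1 < 8)%N && (t.2.2 < 8)%N.
  have : all (fun r => all (fun t => (t.2.1 < 8)%N && (t.2.2 < 8)%N) (pi7 r))
      (iota 1 7) by vm_compute.
  by move=> /allP/(_ r r17)/allP; exact.
suff : 72%:R * leval (fun m i => g (Ev m) (A (Ev c) (Ev i)) +
    bform (Ev c) (Ev i) (Ev m)) (pi7 r) = 0 by move=> h'; lra.
rewrite -[RHS]h mulr_sumr.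
transitivity (\sum_(t <- pi7 r)
    (72%:R * (t.1%:~R * g (Ev t.2.1) (A (Ev c) (Ev t.2.2))) +
    t.1%:~R * leval p (b72_lform th c t.2.2 t.2.1))).
  rewrite big_seq [RHS]big_seq; apply: eq_bigr => t /lt8/andP[t1 t2].
  by rewrite -b72_lformE //; ring.
rewrite big_split -mulr_sumr; congr (_ + _) => /=.
rewrite [RHS]big_mkcond; apply: eq_bigr => t _; rewrite leval_scale.
by case: eqP => [->|//]; rewrite mul0r.
Qed.

(** The formula at a point: (A_X + B_X).Phi = 0, where B_X.Phi is expressed with the
    cross product. *)
Lemma endo_act_formula X Y Z V W :
  endo_act F (A X) [:: Y; Z; V; W] =
    bform X Y (vcross Z V W) - bform X Z (vcross Y V W)
  + bform X V (vcross Y Z W) - bform X W (vcross Y Z V).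
Proof.
have [DL D0] := altform_divergence.
have vL1 c u v w z : vcross (c *: u + v) w z = c *: vcross u w z + vcross v w z.
  rewrite /vcross scaler_sumr -big_split; apply: eq_bigr => m _ /=.
  by rewrite scalerA -scalerDl; congr (_ *: _); exact: (proj1 FA [::] [:: w; z; Ev m]).
have vL2 c u v w z : vcross w (c *: u + v) z = c *: vcross w u z + vcross w v z.
  rewrite /vcross scaler_sumr -big_split; apply: eq_bigr => m _ /=.
  by rewrite scalerA -scalerDl; congr (_ *: _); exact: (proj1 FA [:: w] [:: z; Ev m]).
have vL3 c u v w z : vcross w z (c *: u + v) = c *: vcross w z u + vcross w z v.
  rewrite /vcross scaler_sumr -big_split; apply: eq_bigr => m _ /=.
  by rewrite scalerA -scalerDl; congr (_ *: _); exact: (proj1 FA [:: w; z] [:: Ev m]).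
have bL1 c u v w z : bform (c *: u + v) w z = c * bform u w z + bform v w z.
  rewrite /bform vL1 lee_form_linear (DL [::] [:: w; z]) //=; ring.
have bL2 c u v w z : bform w (c *: u + v) z = c * bform w u z + bform w v z.
  rewrite /bform vL2 lee_form_linear (DL [:: w] [:: z]) //=; ring.
have bL3 c u v w z : bform w z (c *: u + v) = c * bform w z u + bform w z v.
  rewrite /bform vL3 lee_form_linear (DL [:: w; z] [::]) //=; ring.
have bS u v w : bform u v w = - bform u w v.
  have vS : vcross u v w = - vcross u w v.
    rewrite /vcross -sumrN; apply: eq_bigr => m _; rewrite -scaleNr; congr (_ *: _).
    exact: (altform_swap (l := [:: u]) _ _ FA).
  have lN x : lee_form (- x) = - lee_form x.
    have := lee_form_linear (-1) x 0; have := lee_form_linear 1 0 0.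
    rewrite scaler0 !addr0 scaleN1r mul1r => h1 h2; lra.
  rewrite /bform vS lN (altform_swap (l := [:: u]) _ _ altform_divergence) //=; ring.
pose B X' v := \sum_(m < 8) bform X' v (Ev m) *: Ev m.
have bsum (I : Type) (s : seq I) (c : I -> R) (u : I -> E) X' v :
    bform X' v (\sum_(i <- s) c i *: u i) = \sum_(i <- s) c i * bform X' v (u i).
  have b0 : bform X' v 0 = 0.
    by have := bL3 1 0 0 X' v; rewrite scaler0 addr0 mul1r => h; lra.
  by elim/big_rec2: _ => [//|i x y _ <-]; exact: bL3.
have gB X' v w : g (B X' v) w = bform X' v w.
  case: eEv => _ _ eE; rewrite {2}[w]eE bsum gE; apply: eq_bigr => m _.
  rewrite /B (coframe_sum eEv) // (bigD1 m) //= big1 => [|b bm].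
    by case: eEv => _ -> // _; rewrite eqxx mulr1 addr0 mulrC.
  by case: eEv => _ -> // _; rewrite -val_eqE eq_sym in bm; rewrite (negPf bm) mulr0.
pose C X' v := A X' v + B X' v.
have BL2 X' c u v : B X' (c *: u + v) = c *: B X' u + B X' v.
  rewrite /B scaler_sumr -big_split; apply: eq_bigr => m _ /=.
  by rewrite bL2 scalerDl scalerA.
have BL1 c u v w : B (c *: u + v) w = c *: B u w + B v w.
  rewrite /B scaler_sumr -big_split; apply: eq_bigr => m _ /=.
  by rewrite bL1 scalerDl scalerA.
have CL2 X'' c u v : C X'' (c *: u + v) = c *: C X'' u + C X'' v.
  by rewrite /C AL2 BL2 scalerDr addrACA.
have CL1 c u v w : C (c *: u + v) w = c *: C u w + C v w.
  by rewrite /C AL1 BL1 scalerDr addrACA.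
have gDl u v w : g (u + v) w = g u w + g v w by rewrite -{1}[u]scale1r gL mul1r.
have CS X'' u v : g (C X'' u) v = - g u (C X'' v).
  by rewrite [g u _]gC /C !gDl !gB AS [g u _]gC [bform _ u v]bS -opprD.
have FL := proj1 FA.
have act0 : endo_act F (C X) [:: Y; Z; V; W] = 0.
  have base (c : 'I_8) : endo_act F (C (Ev c)) [:: Y; Z; V; W] = 0.
    apply: (spin7_act_eq0 (CL2 _) (CS _)) => // r r8.
    rewrite -[RHS](pi7_bform (ltn_ord c) r8); apply: eq_bigr => t _.
    by congr (_ * _); rewrite [LHS]gC gDl gB gC.
  have C0 w : C 0 w = 0.
    by have := CL1 (-1) 0 0 w; rewrite scaler0 addr0 scaleN1r addNr.
  have sum0 (s : seq 'I_8) :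
      endo_act F (C (\sum_(c <- s) e c X *: Ev c)) [:: Y; Z; V; W] = 0.
    elim: s => [|c s IH].
      rewrite (@endo_act_linear _ _ (-1) _ (C 0) (C 0) _ FL) => [|v].
        by rewrite mulN1r addNr.
      by rewrite big_nil !C0 scaler0 addr0.
    rewrite (@endo_act_linear _ _ (e c X) _ (C (Ev c))
      (C (\sum_(c <- s) e c X *: Ev c)) _ FL) ?base ?IH ?mulr0 ?addr0 //.
    by move=> v; rewrite big_cons CL1.
  by case: eEv => _ _ eE; rewrite [X]eE sum0.
move: act0; rewrite (@endo_act_linear _ _ 1 _ (A X) (B X) _ FL) => [|v]; last first.
  by rewrite scale1r.
rewrite mul1r => /eqP; rewrite addr_eq0 => /eqP ->.
have FB l r v u w z q : (size l + size r).+1 = 4%N ->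
    (forall m, F (l ++ Ev m :: r) = q * F [:: u; w; z; Ev m]) ->
    F (l ++ B X v :: r) = q * bform X v (vcross u w z).
  move=> sz h; rewrite (slot_sum (k := 4)) // bsum mulr_sumr.
  by apply: eq_bigr => m _; rewrite h mulrCA [F _ * _]mulrC.
have sw01 u v w z : F [:: u; v; w; z] = - F [:: v; u; w; z].
  exact: (altform_swap (l := [::]) _ _ FA).
have sw12 u v w z : F [:: u; v; w; z] = - F [:: u; w; v; z].
  exact: (altform_swap (l := [:: u]) _ _ FA).
have sw23 u v w z : F [:: u; v; w; z] = - F [:: u; v; z; w].
  exact: (altform_swap (l := [:: u; v]) _ _ FA).
rewrite /endo_act /=.
rewrite (FB [::] [:: Z; V; W] Y Z V W (-1)) //=; last first.
  by move=> m; rewrite sw01 sw12 sw23; ring.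
rewrite (FB [:: Y] [:: V; W] Z Y V W 1) //=; last first.
  by move=> m; rewrite sw12 sw23; ring.
rewrite (FB [:: Y; Z] [:: W] V Y Z W (-1)) //=; last first.
  by move=> m; rewrite sw23; ring.
rewrite (FB [:: Y; Z; V] [::] W Y Z V 1) //=; last by move=> m; ring.
ring.
Qed.

End SpinAlgebra.

(** * Derivatives in a chart *)

Section Derivatives.
Context {R : realType} {n : nat}.
Local Notation E := 'rV[R]_n.
Implicit Types (x v : E).

Lemma is_derive_sumE m (h : 'I_m -> E -> R) x v (dh : 'I_m -> R) :
  (forall i, is_derive x v (h i) (dh i)) ->
  is_derive x v (fun y => \sum_(i < m) h i y) (\sum_(i < m) dh i).
Proof.
move=> H; have -> : (fun y => \sum_(i < m) h i y) = \sum_(i < m) h i.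
  by apply/funext => y; rewrite fct_sumE.
exact: is_derive_sum.
Qed.

Lemma is_deriveME (f g : E -> R) x v df dg :
  is_derive x v f df -> is_derive x v g dg ->
  is_derive x v (fun y => f y * g y) (df * g x + f x * dg).
Proof.
move=> Hf Hg; rewrite (_ : (fun y => f y * g y) = f * g); last exact/funext.
apply: is_derive_eq; rewrite addrC; congr (_ + _); exact: mulrC.
Qed.

Lemma is_deriveZE (c : R) (f : E -> R) x v df :
  is_derive x v f df -> is_derive x v (fun y => c * f y) (c * df).
Proof. by move=> H; exact: (is_deriveZ c H). Qed.

Lemma differentiable_derive (f : E -> R) x v :
  differentiable f x -> is_derive x v f ('D_v f x).
Proof. by move=> df; apply/derivableP/diff_derivable. Qed.

Lemma derive_dirD (f : E -> R) x c (u v : E) : differentiable f x ->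
  'D_(c *: u + v) f x = c * 'D_u f x + 'D_v f x.
Proof. by move=> df; rewrite !deriveE // linearP. Qed.

Lemma smooth_on_cst (U : set E) (w : E) : smooth_on U (fun _ : E => w).
Proof.
move=> s x _; suff [c ->] : exists c : E,
    foldr (fun v h => 'D_v h) (fun _ => w) s = (fun _ => c).
  exact: differentiable_cst.
elim: s => [|v s [c IH]] /=; first by exists w.
by exists 0; apply/funext => y; rewrite IH derive_cst.
Qed.

(** Leibniz rule for the evaluation of a 1-form on a vector field. *)
Lemma derive_coframe (U : set E) (e : E -> E -> R) (Y : E -> E) x v :
  open U -> U x ->
  (forall w y, U y -> differentiable (fun z => e z w) y) ->
  (forall y, U y -> forall (c : R) (u w : E),
    e y (c *: u + w) = c * e y u + e y w) ->
  differentiable Y x ->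
  is_derive x v (fun y => e y (Y y))
    ('D_v (fun y => e y (Y x)) x + e x ('D_v Y x)).
Proof.
move=> oU Ux eS eL dY.
have nU : \forall y \near x, U y by exact: open_nbhs_nbhs.
have expand y w : U y -> e y w = \sum_(j < n) w 0 j * e y (delta_mx 0 j).
  move=> Uy; have e0 : e y 0 = 0.
    by have := eL y Uy 1 0 0; rewrite scaler0 addr0 mul1r => h; lra.
  rewrite {1}[w]row_sum_delta.
  by elim/big_rec2: _ => [//|j a b _ <-]; exact: eL.
have H (Y' : E -> E) : derivable Y' x v -> is_derive x v (fun y => e y (Y' y))
    (\sum_(j < n) ('D_v Y' x 0 j * e x (delta_mx 0 j) +
       Y' x 0 j * 'D_v (fun y => e y (delta_mx 0 j)) x)).
  move=> dY'; apply: (near_eq_is_derive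
    (f := fun y => \sum_(j < n) Y' y 0 j * e y (delta_mx 0 j))).
    by near=> y; rewrite expand //; near: y.
  apply: is_derive_sumE => j; apply: is_deriveME.
    rewrite derive_mx // mxE; apply: derivableP.
    exact: ((derivable_mxP _ _ _).1 dY' 0 j).
  by apply: differentiable_derive; exact: eS.
apply: is_derive_eq; first by apply: H; exact: diff_derivable.
rewrite big_split /= [LHS]addrC; congr (_ + _); last by rewrite [RHS]expand.
have [_ ->] := H (fun=> Y x) (derivable_cst _ _ _).
by apply: eq_bigr => j _; rewrite derive_cst mxE mul0r add0r.
Unshelve. all: by end_near. Qed.

End Derivatives.

Section ModelExpansion.
Context {R : realType}.
Local Notation E := 'rV[R]_8.

(** The components of Phi in the adapted frames are constants; this makes the
    derivative of Phi computable from those of the coframe. *)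
Lemma model_expand (e : nat -> E -> R) Ev (F : seq E -> R) u v w z :
  dual_bases e Ev -> altform 4 F ->
  (forall vs, size vs = 4%N ->
    F vs = \sum_(t <- spin7_terms) (-1) ^+ t.1 * wdet vs (map e t.2)) ->
  F [:: u; v; w; z] = \sum_(a < 8) \sum_(b < 8) \sum_(c < 8) \sum_(d < 8)
    (phi [:: nat_of_ord a; nat_of_ord b; nat_of_ord c; nat_of_ord d])%:~R *
    (e a u * (e b v * (e c w * e d z))).
Proof.
move=> eEv [FL F0] FE.
rewrite (frame_expand eEv (l := [::]) u FL) //=; apply: eq_bigr => a _.
rewrite (frame_expand eEv (l := [:: _]) v FL) //= mulr_sumr; apply: eq_bigr => b _.
rewrite (frame_expand eEv (l := [:: _; _]) w FL) //= !mulr_sumr; apply: eq_bigr => c _.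
rewrite (frame_expand eEv (l := [:: _; _; _]) z FL) //= !mulr_sumr.
apply: eq_bigr => d _.
rewrite -(phiE eEv FE) //=; last by rewrite !ltn_ord.
by rewrite /=; ring.
Qed.

Lemma is_derive_model x v (m0 m1 m2 m3 : nat -> E -> R) (d0 d1 d2 d3 : nat -> R) :
  (forall a, (a < 8)%N -> [/\ is_derive x v (m0 a) (d0 a),
     is_derive x v (m1 a) (d1 a), is_derive x v (m2 a) (d2 a)
   & is_derive x v (m3 a) (d3 a)]) ->
  is_derive x v (fun y => \sum_(a < 8) \sum_(b < 8) \sum_(c < 8) \sum_(d < 8)
    (phi [:: nat_of_ord a; nat_of_ord b; nat_of_ord c; nat_of_ord d])%:~R *
    (m0 a y * (m1 b y * (m2 c y * m3 d y))))
  (\sum_(a < 8) \sum_(b < 8) \sum_(c < 8) \sum_(d < 8)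
    (phi [:: nat_of_ord a; nat_of_ord b; nat_of_ord c; nat_of_ord d])%:~R *
    (d0 a * (m1 b x * (m2 c x * m3 d x)) + m0 a x * (d1 b * (m2 c x * m3 d x)) +
     m0 a x * (m1 b x * (d2 c * m3 d x)) + m0 a x * (m1 b x * (m2 c x * d3 d)))).
Proof.
move=> H; apply: is_derive_sumE => a; apply: is_derive_sumE => b.
apply: is_derive_sumE => c; apply: is_derive_sumE => d; apply: is_deriveZE.
have [H0 _ _ _] := H _ (ltn_ord a); have [_ H1 _ _] := H _ (ltn_ord b).
have [_ _ H2 _] := H _ (ltn_ord c); have [_ _ _ H3] := H _ (ltn_ord d).
have D := is_deriveME H0 (is_deriveME H1 (is_deriveME H2 H3)).
by apply: (is_derive_eq D); ring.
Qed.
End ModelExpansion.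

(** * Spin(7) structures in a chart *)

Section Chart.
Context {R : realType}.
Local Notation E := 'rV[R]_8.
Variables (U : set E) (x : E) (e : nat -> E -> E -> R).
Variables (g : E -> E -> E -> R) (vol : E -> kcov R 8 8) (Phi : E -> kcov R 8 4).
Hypotheses (oU : open U) (Ux : U x) (eU : coframe_on U e).
Hypotheses (PhiL : forall y, U y -> multilinear (Phi y))
  (PhiA : forall y, U y -> Defs.alternating (Phi y)).
Hypotheses (volL : forall y, U y -> multilinear (vol y))
  (volA : forall y, U y -> Defs.alternating (vol y)).
Hypothesis spinU : forall y, U y ->
  [/\ Phi y = spin7_model (fun a => e a y),
      forall u v, g y u v = \sum_(a < 8) e a y u * e a y v
    & vol y = volume_model (fun a => e a y)].

Let nU : \forall y \near x, U y. Proof. exact: open_nbhs_nbhs. Qed.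

Let frame y : U y -> exists Ev, dual_bases (fun a => e a y) Ev.
Proof.
move=> Uy; case: eU => _ eL e0; apply: dual_bases_exist => [a a8|v]; first exact: eL.
exact: e0.
Qed.

Let PA y : U y -> altform 4 (eval_list (Phi y)).
Proof. by move=> Uy; apply: altform_eval_list; [exact: PhiL | exact: PhiA]. Qed.

Let VA y : U y -> altform 8 (eval_list (vol y)).
Proof. by move=> Uy; apply: altform_eval_list; [exact: volL | exact: volA]. Qed.

Let PE y : U y -> forall vs, size vs = 4%N -> eval_list (Phi y) vs =
  \sum_(t <- spin7_terms) (-1) ^+ t.1 * wdet vs (map (fun a => e a y) t.2).
Proof. by move=> /spinU[-> _ _] vs sv; exact: spin7_modelE. Qed.

Let VE y : U y -> forall vs, size vs = 8%N ->
  eval_list (vol y) vs = wdet vs (map (fun a => e a y) (iota 0 8)).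
Proof.
move=> /spinU[_ _ ->] vs sv.
exact: (@wedge_seq_wdet _ _ [seq e a y | a <- iota 0 8] vs sv).
Qed.

Let gE y : U y -> forall u v, g y u v = \sum_(a < 8) e a y u * e a y v.
Proof. by move=> /spinU[]. Qed.

Lemma hodge_spin7 y : U y ->
  hodge (k := 4) (m := 4) erefl (g y) (vol y) (Phi y) = Phi y.
Proof.
move=> Uy; have [Ev eEv] := frame Uy; apply/funext => w.
rewrite (hodge_frame eEv (gE Uy)); [|exact: (PA Uy).1|exact: (VA Uy).1].
have sW : size [seq w b | b <- enum 'I_4] = 4%N by rewrite size_map size_enum_ord.
rewrite (self_dual eEv (VA Uy) (PE Uy) (VE Uy) sW).
by rewrite mulKf ?pnatr_eq0 // -eval_listE.
Qed.

Variable Ev : nat -> E.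
Hypothesis eEv : dual_bases (fun a => e a x) Ev.

(** The covariant derivative of the constant field w for the flat connection in
    which the frame is parallel. *)
Definition frame_derivative (u w : E) : E :=
  \sum_(a < 8) 'D_u (fun y => e a y w) x *: Ev a.

Let N := frame_derivative.

Let coframe_smooth a w y : (a < 8)%N -> U y -> differentiable (fun z => e a z w) y.
Proof. by move=> a8 Uy; case: eU => eS _ _; exact: (eS a a8 w [::]). Qed.

Let coframe_lin a y : (a < 8)%N -> U y -> forall (c : R) (u w : E),
  e a y (c *: u + w) = c * e a y u + e a y w.
Proof. by move=> a8 Uy; case: eU => _ eL _; exact: eL. Qed.

Let e_sum a (c : nat -> R) : (a < 8)%N -> e a x (\sum_(b < 8) c b *: Ev b) = c a.
Proof.
move=> a8; rewrite (coframe_sum eEv) // (bigD1 (Ordinal a8)) //= big1 => [|b ba].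
  by case: eEv => _ -> // _; rewrite eqxx mulr1 addr0.
case: eEv => _ -> // _; rewrite -val_eqE /= eq_sym in ba.
by rewrite (negPf ba) mulr0.
Qed.

(** The components of Phi are constant, so that only its arguments are
    differentiated, with respect to the flat connection of the frame. *)
Lemma derive_Phi v (Y0 Y1 Y2 Y3 : E -> E) :
  differentiable Y0 x -> differentiable Y1 x ->
  differentiable Y2 x -> differentiable Y3 x ->
  'D_v (fun y => eval_list (Phi y) [:: Y0 y; Y1 y; Y2 y; Y3 y]) x =
    eval_list (Phi x) [:: N v (Y0 x) + 'D_v Y0 x; Y1 x; Y2 x; Y3 x] +
    eval_list (Phi x) [:: Y0 x; N v (Y1 x) + 'D_v Y1 x; Y2 x; Y3 x] +
    eval_list (Phi x) [:: Y0 x; Y1 x; N v (Y2 x) + 'D_v Y2 x; Y3 x] +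
    eval_list (Phi x) [:: Y0 x; Y1 x; Y2 x; N v (Y3 x) + 'D_v Y3 x].
Proof.
move=> d0 d1 d2 d3.
pose m (Y : E -> E) a y := e a y (Y y).
pose dm (Y : E -> E) a := 'D_v (fun y => e a y (Y x)) x + e a x ('D_v Y x).
have mE (Y : E -> E) a : (a < 8)%N -> differentiable Y x ->
    is_derive x v (m Y a) (dm Y a).
  move=> a8 dY; apply: derive_coframe oU Ux _ _ dY => [w y Uy|y Uy].
    exact: coframe_smooth.
  exact: coframe_lin.
have dmE (Y : E -> E) a : (a < 8)%N -> e a x (N v (Y x) + 'D_v Y x) = dm Y a.
  move=> a8; rewrite -[N v _]scale1r coframe_lin // mul1r.
  by rewrite /N /frame_derivative (e_sum (fun b => 'D_v (fun y => e b y (Y x)) x)).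
have H := @is_derive_model R x v (m Y0) (m Y1) (m Y2) (m Y3)
  (dm Y0) (dm Y1) (dm Y2) (dm Y3).
have {}H := H (fun a a8 =>
  And4 (mE _ a a8 d0) (mE _ a a8 d1) (mE _ a a8 d2) (mE _ a a8 d3)).
rewrite (near_eq_derive _ (g := fun y => \sum_(a < 8) \sum_(b < 8) \sum_(c < 8)
   \sum_(d < 8) (phi [:: nat_of_ord a; nat_of_ord b; nat_of_ord c; nat_of_ord d])%:~R *
    (m Y0 a y * (m Y1 b y * (m Y2 c y * m Y3 d y))))); last first.
  near=> y; have Uy : U y by near: y.
  have [Ev' eEv'] := frame Uy.
  exact: (model_expand _ _ _ _ eEv' (PA Uy) (PE Uy)).
have [_ ->] := H.
rewrite !(model_expand _ _ _ _ eEv (PA Ux) (PE Ux)).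
rewrite -!big_split; apply: eq_bigr => a _ /=.
rewrite -!big_split; apply: eq_bigr => b _ /=.
rewrite -!big_split; apply: eq_bigr => c _ /=.
rewrite -!big_split; apply: eq_bigr => d _ /=.
by rewrite !dmE // !mulrDr.
Unshelve. all: by end_near. Qed.

Lemma frame_derivative_linear1 c u v w : N (c *: u + v) w = c *: N u w + N v w.
Proof.
rewrite /N /frame_derivative scaler_sumr -big_split; apply: eq_bigr => a _ /=.
by rewrite derive_dirD ?scalerDl ?scalerA //; exact: coframe_smooth.
Qed.

Lemma frame_derivative_linear2 u c v w : N u (c *: v + w) = c *: N u v + N u w.
Proof.
rewrite /N /frame_derivative scaler_sumr -big_split; apply: eq_bigr => a _ /=.
rewrite scalerA -scalerDl; congr (_ *: _).
rewrite (near_eq_derive _ (g := fun y => c * e a y v + e a y w)); last first.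
  by near=> y; apply: coframe_lin => //; near: y.
have D : is_derive x u (fun y => c * e a y v + e a y w)
    (c * 'D_u (fun y => e a y v) x + 'D_u (fun y => e a y w) x).
  apply: is_deriveD; first apply: is_deriveZE;
    apply: differentiable_derive; exact: coframe_smooth.
by case: D.
Unshelve. all: by end_near. Qed.

Lemma derive_metric u v w :
  'D_u (fun y => g y v w) x = g x (N u v) w + g x v (N u w).
Proof.
rewrite (near_eq_derive _ (g := fun y => \sum_(a < 8) e a y v * e a y w)); last first.
  by near=> y; apply: gE; near: y.
have D : is_derive x u (fun y => \sum_(a < 8) e a y v * e a y w)
    (\sum_(a < 8) ('D_u (fun y => e a y v) x * e a x w +
                   e a x v * 'D_u (fun y => e a y w) x)).
  apply: is_derive_sumE => a.
  by apply: is_deriveME; apply: differentiable_derive; exact: coframe_smooth.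
have [_ ->] := D; rewrite !gE // -big_split; apply: eq_bigr => a _ /=.
rewrite /N /frame_derivative (e_sum (fun b => 'D_u (fun y => e b y v) x)) //.
by rewrite (e_sum (fun b => 'D_u (fun y => e b y w) x)).
Unshelve. all: by end_near. Qed.

Section Connection.
Variable Gam : E -> E -> E.
Hypothesis Gam1 : forall c u v w, Gam (c *: u + v) w = c *: Gam u w + Gam v w.
Hypothesis Gam2 : forall u c v w, Gam u (c *: v + w) = c *: Gam u v + Gam u w.
Hypothesis GamC : forall u v, Gam u v = Gam v u.
Hypothesis Gam_metric : forall u v w,
  'D_u (fun y => g y v w) x = g x (Gam u v) w + g x v (Gam u w).

(** The difference between the flat connection of the frame and that with
    Christoffel symbols Gam. It takes values in so(8) because the metric is parallel
    for both. *)
Definition conn_form (u v : E) : E := N u v - Gam u v.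

Let A := conn_form.

Let gC u v : g x u v = g x v u.
Proof. by rewrite !gE //; apply: eq_bigr => c _; rewrite mulrC. Qed.

Lemma conn_form_linear1 c u v w : A (c *: u + v) w = c *: A u w + A v w.
Proof.
by rewrite /A /conn_form frame_derivative_linear1 Gam1 scalerBr opprD addrACA.
Qed.

Lemma conn_form_linear2 u c v w : A u (c *: v + w) = c *: A u v + A u w.
Proof.
by rewrite /A /conn_form frame_derivative_linear2 Gam2 scalerBr opprD addrACA.
Qed.

Lemma conn_form_skew u v w : g x (A u v) w = - g x v (A u w).
Proof.
have gB a b c : g x (a - b) c = g x a c - g x b c.
  rewrite !gE // -sumrB; apply: eq_bigr => i _.
  by rewrite addrC -scaleN1r coframe_lin // mulN1r mulrDl mulNr addrC.
have := Gam_metric u v w; rewrite derive_metric.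
by rewrite [g x v (A _ _)]gC !gB ![g x _ v]gC => h; lra.
Qed.

Lemma ext_d_spin7 l : size l = 5%N ->
  eval_list (ext_d (fun y => hodge (k := 4) (m := 4) erefl (g y) (vol y) (Phi y)) x) l =
  \sum_(i < 5) (-1) ^+ i * endo_act (eval_list (Phi x)) (N (nth 0 l i)) (del i l).
Proof.
move=> s5; rewrite /eval_list /ext_d; apply: eq_bigr => i _; congr (_ * _).
set l' := del i l; have s4 : size l' = 4%N by rewrite size_del s5.
rewrite (near_eq_derive _ (g := fun y => eval_list (Phi y)
  [:: nth 0 l' 0; nth 0 l' 1; nth 0 l' 2; nth 0 l' 3])); last first.
  near=> y; rewrite hodge_spin7; last by near: y.
  congr (Phi y _); apply/funext => j /=.
  by rewrite -nth_del ?s5 // -/l'; case: j => [[|[|[|[|//]]]] ?].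
have dc (w : E) : differentiable (fun _ : E => w) x by exact: differentiable_cst.
apply: etrans (derive_Phi (nth 0 l i) (dc (nth 0 l' 0)) (dc (nth 0 l' 1))
  (dc (nth 0 l' 2)) (dc (nth 0 l' 3))) _.
by rewrite !derive_cst !addr0.
Unshelve. all: by end_near. Qed.

(** The symmetry of Gam, that is, the absence of torsion, is what leaves only the
    connection form. *)
Lemma codiff_spin7 (w : 'I_3 -> E) :
  codiff (k := 3) (m := 4) erefl erefl g vol Phi x w =
  divergence Ev (eval_list (Phi x)) A [seq w b | b <- enum 'I_3].
Proof.
set W := [seq w b | b <- enum 'I_3].
have sW : size W = 3%N by rewrite size_map size_enum_ord.
have T u := altform_endo_act (PA Ux) (frame_derivative_linear2 u).
have N1 c u v l : endo_act (eval_list (Phi x)) (N (c *: u + v)) l =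
    c * endo_act (eval_list (Phi x)) (N u) l + endo_act (eval_list (Phi x)) (N v) l.
  apply: endo_act_linear; first exact: (PA Ux).1.
  by move=> z; exact: frame_derivative_linear1.
rewrite /codiff; set beta := ext_d _ x.
have bE l (l5 : size l = 5%N) := @ext_d_spin7 l l5 : eval_list beta l = _.
have bL : slot_linear 5 (eval_list beta).
  have [P PE'] : {P : E -> E -> E -> E -> E -> R | forall u a b c d,
      endo_act (eval_list (Phi x)) (N u) [:: a; b; c; d] = P u a b c d}.
    by exists (fun u a b c d => endo_act (eval_list (Phi x)) (N u) [:: a; b; c; d]).
  have P0 c u v a b y z : P (c *: u + v) a b y z = c * P u a b y z + P v a b y z.
    by rewrite -!PE'; exact: N1.
  have P1 c v v' u a b y : P u (c *: v + v') a b y = c * P u v a b y + P u v' a b y.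
    by rewrite -!PE'; exact: ((T u).1 [::] [:: a; b; y]).
  have P2 c v v' u a b y : P u a (c *: v + v') b y = c * P u a v b y + P u a v' b y.
    by rewrite -!PE'; exact: ((T u).1 [:: a] [:: b; y]).
  have P3 c v v' u a b y : P u a b (c *: v + v') y = c * P u a b v y + P u a b v' y.
    by rewrite -!PE'; exact: ((T u).1 [:: a; b] [:: y]).
  have P4 c v v' u a b y : P u a b y (c *: v + v') = c * P u a b y v + P u a b y v'.
    by rewrite -!PE'; exact: ((T u).1 [:: a; b; y] [::]).
  have b5 v0 v1 v2 v3 v4 : eval_list beta [:: v0; v1; v2; v3; v4] =
      P v0 v1 v2 v3 v4 - P v1 v0 v2 v3 v4 + P v2 v0 v1 v3 v4 -
      P v3 v0 v1 v2 v4 + P v4 v0 v1 v2 v3.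
    rewrite bE // !big_ord_recl big_ord0 /del /= !PE'.
    by rewrite /bump /= !exprS expr0; ring.
  move=> l r c u v sz.
  case: l sz => [|y0 [|y1 [|y2 [|y3 [|y4 [|? l]]]]]] sz;
    do ?by exfalso; move: sz => /=; lia.
  - case: r sz => [|z0 [|z1 [|z2 [|z3 [|]]]]] //= _.
    by rewrite !b5 P0 !P1; ring.
  - case: r sz => [|z0 [|z1 [|z2 [|]]]] //= _.
    by rewrite !b5 P0 !P1 !P2; ring.
  - case: r sz => [|z0 [|z1 [|]]] //= _.
    by rewrite !b5 P0 !P2 !P3; ring.
  - case: r sz => [|z0 [|]] //= _.
    by rewrite !b5 P0 !P3 !P4; ring.
  - case: r sz => [|] //= _.
    by rewrite !b5 P0 !P4; ring.
rewrite (hodge_frame eEv (gE Ux) _ _ bL (VA Ux).1) -/W.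
have G u l : size l = 4%N -> endo_act (eval_list (Phi x)) (N u) l =
    \sum_(s < 4) (-1) ^+ s * eval_list (Phi x) (N u (nth 0 l s) :: del s l).
  case: l => [|a [|b [|c [|d [|]]]]] // _.
  have mv l m r y := @altform_move _ _ 4 (eval_list (Phi x)) l m r y (PA Ux).
  rewrite !big_ord_recl big_ord0 /del /endo_act /=.
  rewrite (mv [::] [:: a] [:: c; d]) // (mv [::] [:: a; b] [:: d]) //.
  rewrite (mv [::] [:: a; b; c] [::]) //= /bump /= !exprS expr0.
  ring.
transitivity (- (5`!%:R^-1 * nsum 8 5 (fun I => (\sum_(i < 5) (-1) ^+ i *
    \sum_(s < 4) (-1) ^+ s * eval_list (Phi x) (N (nth 0 (map Ev I) i)
       (nth 0 (del i (map Ev I)) s) :: del s (del i (map Ev I)))) *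
     eval_list (vol x) (map Ev I ++ W)))).
  congr (- (_ * _)); apply: eq_nsum => I sI _; congr (_ * _).
  rewrite bE ?size_map //; apply: eq_bigr => i _; congr (_ * _).
  by rewrite G // size_del ?size_map ?sI.
rewrite (dual_alternation eEv (PA Ux) (VA Ux) (PE Ux) (VE Ux) (gE Ux) N sW).
rewrite (_ : 5`! = 120%N) // mulrN opprK mulKf ?pnatr_eq0 //.
have W3 : W = [:: nth 0 W 0; nth 0 W 1; nth 0 W 2].
  by case: (W) sW => [|? [|? [|? [|]]]].
rewrite W3 (divergence_form eEv (PA Ux) (gE Ux) GamC conn_form_skew) //.
by move=> u v; rewrite /conn_form addrC subrK.
Qed.

Lemma multilinear_codiff :
  multilinear (codiff (k := 3) (m := 4) erefl erefl g vol Phi x).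
Proof.
rewrite (_ : codiff _ _ _ _ _ _ = fun w : 'I_3 -> E =>
    divergence Ev (eval_list (Phi x)) A [seq w b | b <- enum 'I_3]); last first.
  by apply/funext => w; exact: codiff_spin7.
apply: multilinear_list.
exact: (altform_divergence _ (PA Ux) conn_form_linear2).1.
Qed.

Lemma hodge_wedge_spin7 (w : 'I_1 -> E) :
  hodge (k := 3 + 4) (m := 1) erefl (g x) (vol x)
    (wedge (codiff (k := 3) (m := 4) erefl erefl g vol Phi x) (Phi x)) w =
  lee_form Ev (eval_list (Phi x)) A (w ord0).
Proof.
set d := codiff _ _ _ _ _ _.
have dE l : size l = 3%N -> eval_list d l = divergence Ev (eval_list (Phi x)) A l.
  move=> s3; rewrite /eval_list [LHS]codiff_spin7; congr divergence.
  case: l s3 => [|a [|b [|c [|]]]] // _.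
  by rewrite (map_comp (fun i => nth 0 [:: a; b; c] i) val) val_enum_ord.
have wL : slot_linear (3 + 4) (eval_list (wedge d (Phi x))).
  apply: slot_linear_eval_list; apply: wedge_multilinear; first exact: multilinear_codiff.
  exact: PhiL.
rewrite (hodge_frame eEv (gE Ux) _ w wL (VA Ux).1).
have -> : [seq w b | b <- enum 'I_1] = [:: w ord0].
  by rewrite enum_ordSl /= (size0nil (size_enum_ord 0)).
rewrite (dual_wedge eEv (VA Ux) (PE Ux) (VE Ux)) // mulKf; last first.
  by rewrite pnatr_eq0 -lt0n fact_gt0.
congr (_ * _); apply: eq_nsum => J sJ _.
by rewrite dE ?size_map.
Qed.

End Connection.
End Chart.

(** * The covariant derivative of the fundamental form *)

Theorem theorem5p2 (R : realType) (M : manifold R 8) (g : metric M)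
    (vol : kform M 8) (Phi : kform M 4)
    (spin7 : spin7_structure g vol Phi)
    (P : chart M -> 'rV[R]_8 -> 'rV[R]_8 -> 'rV[R]_8 -> 'rV[R]_8 -> 'rV[R]_8)
    (crossP : cross_product g Phi P)
    (nabla : connection M) (LC : levi_civita g nabla)
    (X Y Z V W : vfield M) (i : chart M) (x : 'rV[R]_8) (hx : im_chart i x) :
  let dPhi a b c := delta_Phi g vol Phi i x (tnth [tuple a; b; c]) in
  let theta a := star_delta_Phi_Phi g vol Phi i x (tnth [tuple a]) in
  let Px := P i x in
  let Xx := X i x in let Yx := Y i x in let Zx := Z i x in
  let Vx := V i x in let Wx := W i x in
  cov_form (nabla i) (X i) (Phi i) (tnth [tuple Y i; Z i; V i; W i]) x =
    2^-1 * (dPhi Xx Yx (Px Zx Vx Wx) - dPhi Xx Zx (Px Yx Vx Wx))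
  + 2^-1 * (dPhi Xx Vx (Px Yx Zx Wx) - dPhi Xx Wx (Px Yx Zx Vx))
  - 12^-1 * (theta (Px Xx Yx (Px Zx Vx Wx)) - theta (Px Xx Zx (Px Yx Vx Wx)))
  - 12^-1 * (theta (Px Xx Vx (Px Yx Zx Wx)) - theta (Px Xx Wx (Px Yx Zx Vx))).
Proof.
move=> dPhi theta Px Xx Yx Zx Vx Wx.
have [U [e [oU Ux UM eU spinU]]] := spin7 i x hx.
have PhiL y : U y -> multilinear (Phi i y) by move/UM; exact: kform_multilinear.
have PhiA y : U y -> Defs.alternating (Phi i y) by move/UM; exact: kform_alternating.
have volL y : U y -> multilinear (vol i y) by move/UM; exact: kform_multilinear.
have volA y : U y -> Defs.alternating (vol i y) by move/UM; exact: kform_alternating.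
have [Ev eEv] : exists Ev, dual_bases (fun a => e a x) Ev.
  case: eU => _ eL e0; apply: dual_bases_exist => [a a8|v]; first exact: eL.
  exact: e0.
have gE u v : g i x u v = \sum_(a < 8) e a x u * e a x v.
  by have [_ h _] := spinU x Ux.
have FA : altform 4 (eval_list (Phi i x)).
  by apply: altform_eval_list; [exact: PhiL | exact: PhiA].
have FE vs : size vs = 4%N -> eval_list (Phi i x) vs =
    \sum_(t <- spin7_terms) (-1) ^+ t.1 * wdet vs (map (fun a => e a x) t.2).
  by have [-> _ _] := spinU x Ux => sv; exact: spin7_modelE.
pose Gam := nabla i x.
have Gam1 c u v w : Gam (c *: u + v) w = c *: Gam u w + Gam v w.
  exact: conn_linearl.
have Gam2 u c v w : Gam u (c *: v + w) = c *: Gam u v + Gam u w.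
  exact: conn_linearr.
have sc u := @smooth_on_cst R 8 (im_chart i) u.
have cov_cst u v : cov_vect (nabla i) (fun=> u) (fun=> v) x = Gam u v.
  by rewrite /cov_vect derive_cst add0r.
have GamC u v : Gam u v = Gam v u.
  have := (LC.1) i (fun=> u) (fun=> v) x (sc u) (sc v) hx.
  rewrite !cov_cst /lie_bracket !derive_cst subrr => /eqP.
  by rewrite subr_eq0 => /eqP.
have Gam_metric u v w :
    'D_u (fun y => g i y v w) x = g i x (Gam u v) w + g i x v (Gam u w).
  have := (LC.2) i (fun=> u) (fun=> v) (fun=> w) x (sc u) (sc v) (sc w) hx.
  by rewrite !cov_cst.
pose A := conn_form x e Ev Gam.
have A1 := conn_form_linear1 Ux eU Ev Gam1.
have A2 := conn_form_linear2 oU Ux eU Ev Gam2.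
have AS := conn_form_skew oU Ux eU spinU eEv Gam_metric.
have dPhiE a b c : dPhi a b c = divergence Ev (eval_list (Phi i x)) A [:: a; b; c].
  rewrite /dPhi /delta_Phi (codiff_spin7 oU Ux eU PhiL PhiA volL volA spinU eEv
    GamC Gam_metric).
  by congr divergence; rewrite !enum_ordSl /= (size0nil (size_enum_ord 0)).
have thetaE a : theta a = lee_form Ev (eval_list (Phi i x)) A a.
  rewrite /theta /star_delta_Phi_Phi.
  exact: (hodge_wedge_spin7 oU Ux eU PhiL PhiA volL volA spinU eEv
    Gam2 GamC Gam_metric).
have onT (a b c d : 'rV[R]_8) y :
    Phi i y (tnth [tuple a; b; c; d]) = eval_list (Phi i y) [:: a; b; c; d].
  by congr (Phi i y _); apply/funext => j; rewrite (tnth_nth 0).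
have PxE u v w : Px u v w = vcross Ev (eval_list (Phi i x)) u v w.
  case: (eEv) => _ _ eE; rewrite [LHS]eE; apply: eq_bigr => m _; congr (_ *: _).
  rewrite -(metric_frame eEv gE) -onT -(crossP i x _ _ _ _ hx).
  exact: Defs.metric_sym.
have smooth_diff (T : vfield M) : differentiable (T i) x.
  exact: (@vfield_smooth _ _ _ T i [::] x hx).
have -> : cov_form (nabla i) (X i) (Phi i) (tnth [tuple Y i; Z i; V i; W i]) x =
    endo_act (eval_list (Phi i x)) (A Xx) [:: Yx; Zx; Vx; Wx].
  rewrite /cov_form.
  have -> : (fun y => Phi i y (fun b => tnth [tuple Y i; Z i; V i; W i] b y)) =
      (fun y => eval_list (Phi i y) [:: Y i y; Z i y; V i y; W i y]).
    apply/funext => y; congr (Phi i y _); apply/funext => -[[|[|[|[|//]]]] ?];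
      by rewrite (tnth_nth (Y i)).
  rewrite (derive_Phi oU Ux eU PhiL PhiA spinU eEv) //.
  pose Q (c : 'I_4) := fun b : 'I_4 => if b == c then
    cov_vect (nabla i) (X i) (tnth [tuple Y i; Z i; V i; W i] b) x
    else tnth [tuple Y i; Z i; V i; W i] b x.
  have QE (c : 'I_4) : Phi i x (Q c) = eval_list (Phi i x)
      [:: if c == 0 :> nat then cov_vect (nabla i) (X i) (Y i) x else Yx;
          if c == 1 :> nat then cov_vect (nabla i) (X i) (Z i) x else Zx;
          if c == 2 :> nat then cov_vect (nabla i) (X i) (V i) x else Vx;
          if c == 3 :> nat then cov_vect (nabla i) (X i) (W i) x else Wx].
    congr (Phi i x _); apply/funext => -[[|[|[|[|//]]]] ?];
      by rewrite /Q (tnth_nth (Y i)) -val_eqE eq_sym.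
  under eq_bigr => c _ do rewrite -/(Q c) QE.
  rewrite !big_ord_recl big_ord0 /=.
  have [FL _] := FA.
  have split l r a b c : (size l + size r).+1 = 4%N ->
      eval_list (Phi i x) (l ++ (a + b) :: r) -
      eval_list (Phi i x) (l ++ (b + c) :: r) =
      eval_list (Phi i x) (l ++ (a - c) :: r).
    move=> sz; rewrite !(slotD _ _ FL) // -[- c]scaleN1r (slotZ _ _ FL) //; ring.
  rewrite /endo_act /=.
  have := split [::] [:: Zx; Vx; Wx] (frame_derivative x e Ev Xx Yx)
    ('D_Xx (Y i) x) (Gam Xx Yx) erefl.
  have := split [:: Yx] [:: Vx; Wx] (frame_derivative x e Ev Xx Zx)
    ('D_Xx (Z i) x) (Gam Xx Zx) erefl.
  have := split [:: Yx; Zx] [:: Wx] (frame_derivative x e Ev Xx Vx)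
    ('D_Xx (V i) x) (Gam Xx Vx) erefl.
  have := split [:: Yx; Zx; Vx] [::] (frame_derivative x e Ev Xx Wx)
    ('D_Xx (W i) x) (Gam Xx Wx) erefl.
  rewrite /= => <- <- <- <-; rewrite /cov_vect.
  set t0 := eval_list _ _; set t1 := eval_list _ _.
  set t2 := eval_list _ _; set t3 := eval_list _ _.
  ring.
rewrite (endo_act_formula eEv FA FE gE A1 A2 AS) /bform !dPhiE !thetaE !PxE.
ring.
Qed.
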